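(* Let $G$ be a graph with $n$ vertices, all of them non-isolated. Then the following are equivalent: (1) $G$ satisfies the matching square condition (MSC); (2) for every integer $k\ge 1$, every basic $k$-cover of $G$ has norm $\frac{kn}{2}$; (3) for every integer $k\ge 1$, all basic $k$-covers of $G$ have the same norm; (4) $G$ is unmixed and $G$ is a domain; (5) the ring $\bar{A}(G)$ is a domain (i.e. an integral domain), and the ideal $I(G)$ is unmixed; (6) every connected component of $G^{0-1}$ is a complete bipartite graph $K_{a,a}$, for some positive integer $a$ (depending on the component); (7) $G^{0-1}$ admits a perfect matching; (8) $G$ admits a perfect matching, and all the basic $1$-covers of $G$ have exactly $\frac{n}{2}$ ones.
   Context: Graphs are finite, simple, undirected, with vertex set $\{1,\dots,n\}$, $n\ge 1$. $\mathbb{N}$ denotes the nonnegative integers. For $k\in\mathbb{N}$, a $k$-cover of $G$ is a nonzero vector $\mathbf{a}=(a_1,\dots,a_n)\in\mathbb{N}^n$ such that $a_i+a_j\ge k$ for every edge $\{i,j\}$ of $G$. A $k$-cover is basic if it cannot be written as the (vertex-wise) sum of a $k$-cover and a $0$-cover (covers are nonzero by definition). The norm of a $k$-cover $\mathbf{a}$ is $|\mathbf{a}|=\sum_{i=1}^n a_i$. $G$ is unmixed if all its basic $1$-covers have the same number of ones (entries equal to $1$). $G$ is a domain if for all $s,t\in\mathbb{N}$, not both zero, the sum of any $s$ basic $1$-covers (repetitions allowed) and any $t$ basic $2$-covers (repetitions allowed) of $G$ is a basic $(s+2t)$-cover of $G$. $G$ satisfies MSC if the graph $G^{red}$ obtained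 by deleting all the isolated vertices of $G$ is non-empty and admits a perfect matching such that for each edge $\{i,j\}$ of the matching, and for all edges $\{i,i'\}$ and $\{j,j'\}$ of $G$, $\{i',j'\}$ is also an edge of $G$ (in particular $i'\neq j'$). Let $S=K[x_1,\dots,x_n]$ be a polynomial ring over some field $K$ with irrelevant ideal $\mathfrak{m}=(x_1,\dots,x_n)$. The edge ideal $I(G)\subset S$ is generated by all monomials $x_ix_j$ with $\{i,j\}$ an edge of $G$; an ideal is unmixed if all its associated primes have the same height. The cover ideal of $G$ is $J(G)=\bigcap_{\{i,j\}}(x_i,x_j)$, the intersection over all edges $\{i,j\}$ of $G$. Let $J(G)^{(k)}$ be its $k$-th symbolic power, $R_s(J(G))=\bigoplus_{k\ge 0}J(G)^{(k)}$ its symbolic Rees algebra, and $\bar{A}(G)=R_s(J(G))/\mathfrak{m}R_s(J(G))$ (the symbolic fiber cone of $J(G)$). For a graph $G$ with at least one edge, $G^{0-1}$ is the graph whose vertices are the vertices of $G^{red}$ and whose edges are the edges $\{i,j\}$ of $G$ such that $a_i+a_j=1$ for every basic $1$-cover $\mathbf{a}$ of $G$. *)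

(* Defs.v *)
From HB Require Import structures.
From mathcomp Require Import all_boot all_order all_algebra.
From mathcomp Require Import mpoly.
From mathcomp Require Import boolp.

Set Implicit Arguments.
Unset Strict Implicit.
Unset Printing Implicit Defensive.

Import GRing.Theory.
Local Open Scope ring_scope.

Record sgraph (T : finType) := SGraph {
  adj : rel T;
  adj_sym : ssrbool.symmetric adj;
  adj_irrefl : irreflexive adj }.

Definition norm_cover (T : finType) (a : {ffun T -> nat}) : nat :=
  (\sum_i a i)%N.

Definition num_ones (T : finType) (a : {ffun T -> nat}) : nat :=
  #|[set i | a i == 1%N]|.

Section Graphs.
Variables (T : finType) (G : sgraph T).

Definition isolated (i : T) : bool := [forall j, ~~ adj G i j].

Definition edges : {set {set T}} :=
  [set [set p.1; p.2] | p in [pred p : T * T | adj G p.1 p.2]].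

Definition perfect_matching (M : {set {set T}}) : bool :=
  (M \subset edges) && partition M [set: T].

Definition has_perfect_matching : Prop := exists M, perfect_matching M.

Definition component (x : T) : {set T} := [set y | connect (adj G) x y].

(* [adj] is constrained on [C] only: the induced subgraph is K_{a,b}. *)
Definition complete_bipartite_on (C : {set T}) (a b : nat) : Prop :=
  exists A B : {set T},
    [/\ A :|: B = C, [disjoint A & B], #|A| = a, #|B| = b
      & {in C &, forall x y,
           adj G x y = (x \in A) && (y \in B) || (x \in B) && (y \in A)}].

Definition kcover (k : nat) (a : {ffun T -> nat}) : Prop :=
  a != 0 /\ forall i j, adj G i j -> (k <= a i + a j)%N.

Definition basic_kcover (k : nat) (a : {ffun T -> nat}) : Prop :=
  kcover k a /\ ~ exists b c, [/\ kcover k b, kcover 0 c & a = b + c].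

Definition unmixed_graph : Prop :=
  forall a b, basic_kcover 1 a -> basic_kcover 1 b ->
    num_ones a = num_ones b.

Definition domain_graph : Prop :=
  forall (s t : nat) (a : 'I_s -> {ffun T -> nat}) (b : 'I_t -> {ffun T -> nat}),
    ~~ ((s == 0%N) && (t == 0%N)) ->
    (forall i, basic_kcover 1 (a i)) -> (forall j, basic_kcover 2 (b j)) ->
    basic_kcover (s + 2 * t)%N (\sum_i a i + \sum_j b j).

Definition red_vertex : finType := {i : T | ~~ isolated i}.

Definition red_adj : rel red_vertex := fun i j => adj G (val i) (val j).

Lemma red_adj_sym : ssrbool.symmetric red_adj.
Proof. by move=> i j; rewrite /red_adj adj_sym. Qed.

Lemma red_adj_irrefl : irreflexive red_adj.
Proof. by move=> i; rewrite /red_adj adj_irrefl. Qed.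

Definition red_graph : sgraph red_vertex := SGraph red_adj_sym red_adj_irrefl.

Definition adj01 : rel red_vertex := fun i j =>
  adj G (val i) (val j) &&
  `[< forall a, basic_kcover 1 a -> (a (val i) + a (val j))%N = 1%N >].

Lemma adj01_sym : ssrbool.symmetric adj01.
Proof.
move=> i j; rewrite /adj01 adj_sym; congr (_ && _).
by apply/asboolP/asboolP => H a /H; rewrite addnC.
Qed.

Lemma adj01_irrefl : irreflexive adj01.
Proof. by move=> i; rewrite /adj01 adj_irrefl. Qed.

Definition graph01 : sgraph red_vertex := SGraph adj01_sym adj01_irrefl.

End Graphs.

Definition MSC (T : finType) (G : sgraph T) : Prop :=
  (0 < #|red_vertex G|)%N /\
  exists M : {set {set red_vertex G}},
    perfect_matching (red_graph G) M /\
    forall i j : red_vertex G, [set i; j] \in M ->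
    forall i' j' : T, adj G (val i) i' -> adj G (val j) j' -> adj G i' j'.

(* Subsets of a ring, in particular ideals, are Prop-valued membership
   predicates; ideals are compared extensionally. *)
Section Ideals.
Variable R : comNzRingType.
Implicit Types I P E : R -> Prop.

Definition is_ideal I : Prop :=
  [/\ I 0, forall x y, I x -> I y -> I (x + y) & forall a x, I x -> I (a * x)].

Definition ideal_gen E : R -> Prop := fun x =>
  exists (m : nat) (c g : 'I_m -> R),
    (forall i, E (g i)) /\ x = \sum_i c i * g i.

Definition ideal_pow I (k : nat) : R -> Prop :=
  ideal_gen (fun x => exists f : 'I_k -> R, (forall i, I (f i)) /\ x = \prod_i f i).

Definition prime_ideal P : Prop :=
  [/\ is_ideal P, ~ P 1 & forall x y, P (x * y) -> P x \/ P y].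

Definition associated_prime I P : Prop :=
  prime_ideal P /\ exists f, forall r, P r <-> I (r * f).

Definition strict_sub P Q : Prop :=
  (forall x, P x -> Q x) /\ exists x, Q x /\ ~ P x.

Definition prime_chain P (h : nat) : Prop :=
  exists Q : nat -> R -> Prop,
    [/\ forall i, (i <= h)%N -> prime_ideal (Q i),
        forall i, (i < h)%N -> strict_sub (Q i) (Q i.+1)
      & forall x, Q h x <-> P x].

Definition has_height P (h : nat) : Prop :=
  prime_chain P h /\ forall h', prime_chain P h' -> (h' <= h)%N.

Definition unmixed_ideal I : Prop :=
  exists h, forall P, associated_prime I P -> has_height P h.

(* The intersection, over the associated primes P of I, of the contractions
   to R of I^k R_P.  For radical ideals, such as the cover ideals below, the
   associated primes are the minimal primes, so the two usual conventions for
   symbolic powers agree. *)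
Definition symbolic_power I (k : nat) : R -> Prop := fun f =>
  forall P, associated_prime I P -> exists2 s, ~ P s & ideal_pow I k (s * f).

Lemma ideal_gen_is_ideal E : is_ideal (ideal_gen E).
Proof.
split.
- by exists 0%N, (fun _ => 0), (fun _ => 0); split=> [[]|]; rewrite ?big_ord0.
- move=> x y [m [c [g [Eg ->]]]] [m' [c' [g' [Eg' ->]]]].
  exists (m + m')%N, (fun i => match split i with inl j => c j | inr j => c' j end),
    (fun i => match split i with inl j => g j | inr j => g' j end).
  split=> [i|]; first by case: (split i).
  rewrite big_split_ord; congr (_ + _); apply: eq_bigr => i _.
    by rewrite -[lshift _ _]/(unsplit (inl i)) unsplitK.
  by rewrite -[rshift _ _]/(unsplit (inr i)) unsplitK.
- move=> a x [m [c [g [Eg ->]]]]; exists m, (fun i => a * c i), g; split=> //.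
  by rewrite mulr_sumr; apply: eq_bigr => i _; rewrite mulrA.
Qed.

Lemma ideal_gen_sum E (m : nat) (F : 'I_m -> R) :
  (forall i, ideal_gen E (F i)) -> ideal_gen E (\sum_i F i).
Proof.
have [E0 ED _] := ideal_gen_is_ideal E.
by move=> EF; apply: (big_ind (ideal_gen E)).
Qed.

Lemma ideal_powM I a b x y :
  ideal_pow I a x -> ideal_pow I b y -> ideal_pow I (a + b) (x * y).
Proof.
have [_ _ PM] : is_ideal (ideal_pow I (a + b)) by exact: ideal_gen_is_ideal.
move=> [m [c [g [Eg ->]]]] [m' [c' [g' [Eg' ->]]]].
rewrite mulr_suml; apply: ideal_gen_sum => i.
rewrite mulr_sumr; apply: ideal_gen_sum => j.
rewrite mulrACA; apply: PM.
have [f [If ->]] := Eg i; have [f' [If' ->]] := Eg' j.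
exists 1%N, (fun _ => 1), (fun _ => (\prod_i f i) * (\prod_i f' i)).
split=> [_|]; last by rewrite big_ord1 mul1r.
exists (fun i => match split i with inl j => f j | inr j => f' j end).
split=> [k|]; first by case: (split k).
rewrite big_split_ord; congr (_ * _); apply: eq_bigr => k _.
  by rewrite -[lshift _ _]/(unsplit (inl k)) unsplitK.
by rewrite -[rshift _ _]/(unsplit (inr k)) unsplitK.
Qed.

Lemma symbolic_power_is_ideal I k : is_ideal (symbolic_power I k).
Proof.
have [P0 PD PM] : is_ideal (ideal_pow I k) by exact: ideal_gen_is_ideal.
split=> [P [[_ P1 _] _]|x y Ix Iy P aP|a x Ix P aP].
- by exists 1; rewrite ?mulr0.
- have [s Ps Isx] := Ix P aP; have [t Pt Ity] := Iy P aP.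
  have [[_ _ PP] _] := aP; exists (s * t); first by move/PP => [].
  by rewrite mulrDr mulrAC -[s * t * y]mulrA mulrC; apply: PD; apply: PM.
- by have [s Ps Isx] := Ix P aP; exists s => //; rewrite mulrCA; apply: PM.
Qed.

Lemma symbolic_powerM I a b x y :
  symbolic_power I a x -> symbolic_power I b y ->
  symbolic_power I (a + b) (x * y).
Proof.
move=> Ix Iy P aP; have [s Ps Isx] := Ix P aP; have [t Pt Ity] := Iy P aP.
have [[_ _ PP] _] := aP; exists (s * t); first by move/PP => [].
by rewrite mulrACA; apply: ideal_powM.
Qed.

(* The symbolic Rees algebra, as the graded subring of R[t] whose
   degree k part is I^(k) t^k. *)
Definition in_sym_rees I : {pred {poly R}} :=
  fun p => `[< forall k, symbolic_power I k p`_k >].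

Lemma in_sym_rees_subring I : subring_closed (in_sym_rees I).
Proof.
have sI k := symbolic_power_is_ideal I k.
split=> [|p q /asboolP Ip /asboolP Iq|p q /asboolP Ip /asboolP Iq];
  apply/asboolP => k; have [I0 ID IM] := sI k.
- rewrite coef1; case: eqP => [->|_] //= P [[_ P1 _] _]; exists 1 => //.
  exists 1%N, (fun _ => 1), (fun _ => 1); rewrite big_ord1 mulr1; split=> // _.
  by exists (fun _ => 1); split=> [[]|]; rewrite ?big_ord0.
- by rewrite coefB -mulN1r; apply: ID => //; apply: IM.
- rewrite coefM; apply: (big_ind (symbolic_power I k)) => // i _.
  by rewrite -{1}(subnKC (leq_ord i)); apply: symbolic_powerM.
Qed.

HB.instance Definition _ I :=
  GRing.isSubringClosed.Build {poly R} (in_sym_rees I) (in_sym_rees_subring I).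

Record sym_rees I := SymRees {
  sym_rees_val : {poly R};
  _ : sym_rees_val \in in_sym_rees I }.

HB.instance Definition _ I := [isSub for @sym_rees_val I].
HB.instance Definition _ I := [Choice of sym_rees I by <:].
HB.instance Definition _ I := [SubChoice_isSubComNzRing of sym_rees I by <:].

End Ideals.

Section PolynomialRing.
Variables (n : nat) (K : fieldType).
Local Notation S := {mpoly K[n]}.

Definition irrelevant_ideal : S -> Prop :=
  ideal_gen (fun f => exists i, f = 'X_i).

Definition edge_ideal (G : sgraph 'I_n) : S -> Prop :=
  ideal_gen (fun f => exists i j, adj G i j /\ f = 'X_i * 'X_j).

Definition cover_ideal (G : sgraph 'I_n) : S -> Prop := fun f =>
  forall i j, adj G i j -> ideal_gen (fun g => g = 'X_i \/ g = 'X_j) f.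

Section FiberCone.
Variable I : S -> Prop.

(* The ideal m R_s(I): elements of m are viewed in degree 0. *)
Definition irrelevant_ext : sym_rees I -> Prop :=
  ideal_gen (fun p => exists2 c, irrelevant_ideal c & val p = c%:P).

Definition in_irrelevant_ext : {pred sym_rees I} :=
  fun p => `[< irrelevant_ext p >].

Lemma irrelevant_ideal_eval0 c : irrelevant_ideal c -> c.@[fun _ => 0] = 0.
Proof.
case=> m [d [g [Xg ->]]]; rewrite raddf_sum big1 //= => i _.
by have [j ->] := Xg i; rewrite mevalM mevalXU mulr0.
Qed.

Lemma irrelevant_ext_eval0 (p : sym_rees I) :
  irrelevant_ext p -> ((val p)`_0).@[fun _ => 0] = 0.
Proof.
case=> m [c [g [mg ->]]].
rewrite (raddf_sum (val : sym_rees I -> {poly S})) coef_sum raddf_sum big1 //= => i _.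
have [d md gd] := mg i; rewrite /= in gd.
by rewrite gd coefMC mevalM (irrelevant_ideal_eval0 md) mulr0.
Qed.

Lemma irrelevant_ext_idealr : idealr_closed in_irrelevant_ext.
Proof.
have [I0 ID IM] : is_ideal irrelevant_ext by exact: ideal_gen_is_ideal.
split; first exact/asboolP.
  apply/asboolP => /irrelevant_ext_eval0 /eqP.
  by rewrite (rmorph1 (val : sym_rees I -> {poly S})) coef1 meval1 oner_eq0.
by move=> a u v /asboolP Iu /asboolP Iv; apply/asboolP/ID => //; apply: IM.
Qed.

HB.instance Definition _ :=
  isIdealr.Build (sym_rees I) in_irrelevant_ext irrelevant_ext_idealr.

Definition sym_fiber_cone : comNzRingType := {ideal_quot in_irrelevant_ext}.

End FiberCone.
End PolynomialRing.

Arguments edge_ideal {n} K G _.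
Arguments cover_ideal {n} K G _.

(* Main.v *)
Require Import Defs.
From mathcomp Require Import all_boot all_order all_algebra.
From mathcomp Require Import mpoly.
From mathcomp Require Import boolp zify.

(** All eight conditions are read off from the minimal covers.  A [k]-cover is
    basic exactly when every vertex of positive value lies on an edge on which the
    cover is tight, and two vertices are adjacent exactly when every minimal 1-cover
    has value at least 1 on the pair ([adj_mincovP]); pairs on which the value is
    always 1 are the edges of G^{0-1}, and they have the square property of MSC
    ([rigid_square]).

    Combinatorics.  For a matching with the square property every basic [k]-cover is
    tight on the matching edges ([matched_square_norm]), which fixes its norm.  If
    norms only depend on [k], they are linear in [k], so a sum of minimal covers
    cannot lie strictly above a minimal cover and is itself minimal
    ([constant_norm_additive]).  Additivity of minimal covers is the same as being a
    domain because every cover splits into covers of degree 1 and 2 ([cov_split]).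
    Conversely additivity gives every vertex a neighbour in G^{0-1}
    ([additive_rigid]); the components of that graph are then complete bipartite, and
    some minimal 1-cover can be complemented on a prescribed component
    ([flip_component]), so unmixedness makes the two sides equal.  Balanced complete
    bipartite components have perfect matchings, and a perfect matching of G^{0-1}
    halves the number of vertices in every minimal 1-cover.  Finally, if all minimal
    1-covers have half of the vertices, the edges of a perfect matching are rigid,
    which is MSC.

    Algebra.  The associated primes of an intersection of monomial primes are among
    these primes ([associated_prime_inter]).  For the edge ideal they are the primes
    of the supports of minimal 1-covers; since the height of a monomial prime is its
    number of variables ([monomial_prime_height]), the ideal is unmixed exactly when
    the graph is.  The heights follow from the bound [n] on the length of a chain of
    primes: a chain produces algebraically independent elements
    ([chain_independent]), whereas a dimension count makes any [n + 1] polynomials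
    dependent ([algebraic_dependence]).  For the cover ideal the associated primes
    correspond to the edges, so its [k]-th symbolic power is spanned by the monomials
    of [k]-covers ([symbolic_power_cover]).  Dividing by the irrelevant ideal kills
    exactly the covers that are not minimal ([irrelevant_extP]), and the fiber cone is
    a domain exactly when minimal covers add up to minimal covers
    ([fiber_cone_domain_additive]). *)

Set Implicit Arguments.
Unset Strict Implicit.
Unset Printing Implicit Defensive.

Import GRing.Theory.
Local Open Scope ring_scope.

Lemma ffun_addE (T : finType) (a b : {ffun T -> nat}) x :
  (a + b) x = (a x + b x)%N.
Proof. by rewrite ffunE. Qed.

(** * Covers and tight covers *)

Section Covers.
Variables (T : finType) (G : sgraph T).
Implicit Types (a b : T -> nat) (x y : T).

Definition cov k a : Prop := forall i j, adj G i j -> (k <= a i + a j)%N.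

(** A cover is minimal exactly when each vertex of positive value lies on a
    tight edge.  The condition is local, makes sense for the zero vector and for
    [k = 0] (where it forces [a = 0]), and agrees with basicness when [k > 0] and
    no vertex is isolated; then the pairs [(k, a)] with [mincov k a] index a basis of the fiber cone. *)
Definition mincov k a : Prop :=
  cov k a /\ forall i, (0 < a i)%N -> exists2 j, adj G i j & (a i + a j = k)%N.

Lemma mincov_ext k a b : a =1 b -> mincov k a -> mincov k b.
Proof. by move=> /funext ->. Qed.

Lemma covD k l a b : cov k a -> cov l b -> cov (k + l) (fun i => a i + b i)%N.
Proof. by move=> Ca Cb i j ij; have := Ca _ _ ij; have := Cb _ _ ij; lia. Qed.

(** One unit can be taken away at [i] because no edge at [i] is tight; at value 0
    the truncated subtraction changes nothing. *)
Lemma cov_decr k a i : cov k a ->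
  ~ (exists2 j, adj G i j & (a i + a j = k)%N) ->
  cov k (fun x => a x - (x == i))%N.
Proof.
move=> Ca nt u v uv; have Cuv := Ca _ _ uv.
case: (eqVneq u i) => [ui|_]; case: (eqVneq v i) => [vi|_] /=; last lia.
- by move: uv; rewrite ui vi adj_irrefl.
- subst u; suff : (a i + a v)%N <> k by lia.
  by move=> E; apply: nt; exists v.
- subst v; suff : (a i + a u)%N <> k by lia.
  by move=> E; apply: nt; exists u; rewrite // adj_sym.
Qed.

(** Lowering the value at [i] would break the tight edge at [i]. *)
Lemma mincov_min k a b : mincov k a -> cov k b -> (forall i, b i <= a i)%N ->
  b =1 a.
Proof.
move=> [Ca ta] Cb le_ba i; apply/eqP; rewrite eqn_leq le_ba /= leqNgt; apply/negP => lt.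
have [|j ij E] := ta i; first by apply: leq_ltn_trans lt.
by have := Cb _ _ ij; have := le_ba j; lia.
Qed.

Lemma cov_has_mincov k a : cov k a ->
  exists b : {ffun T -> nat}, mincov k b /\ forall i, (b i <= a i)%N.
Proof.
have [m] := ubnP (\sum_i a i)%N; elim: m a => // m IH a lt_am Ca.
have [ta|/existsNP[i /not_implyP[ai nt]]] :=
  pselect (forall i, (0 < a i)%N -> exists2 j, adj G i j & (a i + a j = k)%N).
  exists [ffun i => a i]; split=> [|i]; last by rewrite ffunE.
  by apply: (@mincov_ext _ a) => // i; rewrite ffunE.
have [|b [mb le_b]] := IH (fun x => a x - (x == i))%N _ (cov_decr Ca nt).
  move: lt_am; rewrite (bigD1 i) //= [X in (_ -> X < _)%N](bigD1 i) //= eqxx.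
  suff -> : (\sum_(j | j != i) (a j - (j == i)) = \sum_(j | j != i) a j)%N by lia.
  by apply: eq_bigr => j /negbTE ->; rewrite subn0.
by exists b; split=> // j; apply: leq_trans (le_b j) (leq_subr _ _).
Qed.

Lemma mincov_le k a i : mincov k a -> (a i <= k)%N.
Proof. by move=> [_ ta]; case: (posnP (a i)) => [->//|/ta[j _]]; lia. Qed.

(** The complement of a maximal independent set containing [F]: any minimal
    1-cover below the indicator function of the complement of [F]. *)
Lemma mincov_avoid (F : pred T) : {in F &, forall x y, ~~ adj G x y} ->
  exists a : {ffun T -> nat}, mincov 1 a /\ {in F, forall x, a x = 0%N}.
Proof.
move=> Find; have [i j ij|b [mb le_b]] := @cov_has_mincov 1 (fun x => (x \notin F) : nat).
  case iF: (i \in F) => //=; case jF: (j \in F) => //=.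
  by have := Find _ _ iF jF; rewrite ij.
by exists b; split=> // x xF; have := le_b x; rewrite xF; case: (b x).
Qed.

(** The minimal 1-covers determine the graph, which reduces the combinatorial
    arguments below to linear arithmetic with their values.  For [x = y] both sides are
    false, by [mincov_avoid] applied to a single vertex. *)
Lemma adj_mincovP x y :
  adj G x y <-> forall a : {ffun T -> nat}, mincov 1 a -> (1 <= a x + a y)%N.
Proof.
split=> [xy a [Ca _]|H]; first exact: Ca.
apply/contraT => nxy; have [u v|a [/H]] := @mincov_avoid (pred2 x y); last first.
  by move=> + a0; rewrite !a0 ?inE ?eqxx ?orbT.
by rewrite !inE => /pred2P[] -> /pred2P[] ->; rewrite ?adj_irrefl // adj_sym.
Qed.

Lemma mincov_scale k a : mincov 1 a -> mincov k (fun x => k * a x)%N.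
Proof.
move=> [Ca ta]; split=> [i j /Ca|i]; first by rewrite -mulnDr; nia.
by rewrite muln_gt0 => /andP[_ /ta[j ij E]]; exists j; rewrite -?mulnDr ?E ?muln1.
Qed.

Lemma basic_mincov k (a : {ffun T -> nat}) : (0 < k)%N ->
  (forall i, ~~ isolated G i) -> (0 < #|T|)%N ->
  basic_kcover G k a <-> mincov k a.
Proof.
move=> k_gt0 noiso /card_gt0P[x0 _].
have nbr x : exists y, adj G x y.
  by have /forallPn[y /negPn xy] := noiso x; exists y.
have nz (b : {ffun T -> nat}) : cov k b -> b != 0.
  move=> Cb; apply/eqP => b0; have [y xy] := nbr x0.
  by have := Cb _ _ xy; rewrite b0 !ffunE; lia.
split=> [[[_ Ca] na]|ma].
  split=> // i ai; apply: contrapT => nt; apply: na.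
  pose b := [ffun x => a x - (x == i)]%N; pose c := [ffun x => (x == i) : nat].
  have Cb : cov k b.
    by move=> u v uv; rewrite !ffunE; apply: (cov_decr Ca nt uv).
  exists b, c; split; last 1 first.
  - apply/ffunP => x; rewrite ffun_addE !ffunE.
    by case: eqP => [->|] /=; lia.
  - by split=> //; exact: nz.
  split=> //; apply/eqP => /ffunP /(_ i); rewrite !ffunE eqxx.
  by move/eqP; rewrite oner_eq0.
split; first by have [Ca _] := ma; split=> //; apply: nz.
case=> b [c [[_ Cb] [c_nz _] E]].
have /ffunP bE : b = a.
  apply/ffunP; apply: (mincov_min ma Cb) => x.
  by rewrite E ffun_addE leq_addr.
case/eqP: c_nz; apply/ffunP => x; have := bE x.
by rewrite E ffun_addE ffunE => /esym/eqP; rewrite -{2}[b x]addn0 eqn_add2l => /eqP.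
Qed.

(** On an edge that is tight for the sum, both summands are tight. *)
Lemma mincov_addl k l (a b : T -> nat) :
  mincov (k + l) (fun i => a i + b i)%N -> cov k a -> cov l b ->
  mincov k a.
Proof.
move=> [_ tab] Ca Cb; split=> // i ai; have [|j ij] := tab i; first lia.
by exists j => //; have := Ca _ _ ij; have := Cb _ _ ij; lia.
Qed.

(** This is why the algebra of covers is generated in degrees 1 and 2: the
    2-cover to be split off has values 0, 1, 2 according to whether [a i] is zero,
    strictly between 0 and the degree, or at least the degree. *)
Lemma cov_split k (a : T -> nat) : cov k.+2 a ->
  exists b c : {ffun T -> nat},
    [/\ cov 2 b, cov k c & forall i, a i = (b i + c i)%N].
Proof.
move=> Ca; pose b i := if a i == 0%N then 0%N else if (k.+2 <= a i)%N then 2%N else 1%N.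
have le_ba i : (b i <= a i)%N by rewrite /b; case: ifP => //; case: ifP; lia.
exists [ffun i => b i], [ffun i => a i - b i]%N; split=> [i j ij|i j ij|i].
- by rewrite !ffunE /b; have := Ca _ _ ij; do ![case: ifP]; lia.
- by rewrite !ffunE /b; have := Ca _ _ ij; do ![case: ifP]; lia.
- by rewrite !ffunE subnKC.
Qed.

End Covers.

(** * Rigid pairs and flipping a component of G^{0-1} *)

Section Rigidity.
Variables (T : finType) (G : sgraph T).
Implicit Types x y : T.

Lemma norm_addE (a b : {ffun T -> nat}) :
  norm_cover (a + b) = (norm_cover a + norm_cover b)%N.
Proof.
by rewrite /norm_cover -big_split; apply: eq_bigr => i _; rewrite ffun_addE.
Qed.

Lemma num_ones_norm (a : {ffun T -> nat}) : mincov G 1 a ->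
  num_ones a = norm_cover a.
Proof.
move=> ma; rewrite /num_ones /norm_cover -sum1_card big_mkcond /=.
apply: eq_bigr => i _; rewrite inE.
by have := mincov_le i ma; case: (a i) => [|[]].
Qed.

(** The edges of G^{0-1}; adjacency is a consequence, by [rigid_adj]. *)
Definition rigid x y := forall a : {ffun T -> nat}, mincov G 1 a -> (a x + a y = 1)%N.

Lemma rigid_sym x y : rigid x y -> rigid y x.
Proof. by move=> r a /r; rewrite addnC. Qed.

Lemma rigid_adj x y : rigid x y -> adj G x y.
Proof. by move=> r; apply/adj_mincovP => a /r ->. Qed.

(** Of a rigid pair [x], [y], one vertex has value 0 in any given 1-cover; its
    neighbour among [x'], [y'] then has value 1.  Hence [x'], [y'] are covered by every
    minimal 1-cover, that is, adjacent. *)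
Lemma rigid_square x y x' y' :
  rigid x y -> adj G x x' -> adj G y y' -> adj G x' y'.
Proof.
move=> r /adj_mincovP xx /adj_mincovP yy; apply/adj_mincovP => a ma.
by have := r _ ma; have := xx _ ma; have := yy _ ma; lia.
Qed.

Lemma mincov_vanish x : exists a : {ffun T -> nat}, mincov G 1 a /\ a x = 0%N.
Proof.
have [u v|a [ma a0]] := @mincov_avoid T G (pred1 x).
  by rewrite !inE => /eqP -> /eqP ->; rewrite adj_irrefl.
by exists a; rewrite a0 ?inE.
Qed.

(** The other relation that two vertices of one component of G^{0-1} can be in. *)
Definition same_value x y := forall a : {ffun T -> nat}, mincov G 1 a -> a x = a y.

Lemma same_nadj x y : same_value x y -> ~ adj G x y.
Proof.
move=> s xy; have [a [ma a0]] := mincov_vanish x.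
by have := proj1 ma _ _ xy; rewrite -(s _ ma) a0.
Qed.

Section Flip.
Hypothesis nbr : forall x, exists y, rigid x y.
Variable C : {set T}.
Hypothesis C_closed : forall x y, rigid x y -> x \in C -> y \in C.
Hypothesis C_par : {in C &, forall x y, same_value x y \/ rigid x y}.

(* In the application [C] is a component of G^{0-1}; [N] is its outer boundary
   in [G], and [F] consists of the vertices outside [C] rigidly paired with [N]. *)
Let N x := x \notin C /\ exists2 y, y \in C & adj G x y.
Let F q := exists2 p, N p & rigid p q.

(** Otherwise [p] and [q] have neighbours [x] and [y] in [C].  If [x] and [y]
    always take the same value, a cover vanishing at [x] would give value 1 to both [p]
    and [q]; if they are rigid, the two inequalities on the edges [px] and [qy] add up
    to an equality, which makes [x] and [p] rigid and puts [p] into [C]. *)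
Lemma boundary_partner p q : N p -> rigid p q -> ~ N q.
Proof.
move=> [pC [x xC px]] r [qC [y yC qy]]; case: (C_par xC yC) => [s|r'].
  have [a [ma a0]] := mincov_vanish x; have := s _ ma; have := r _ ma.
  by have := proj1 ma _ _ px; have := proj1 ma _ _ qy; lia.
suff /C_closed /(_ xC) : rigid x p by rewrite (negbTE pC).
move=> a ma; have := r _ ma; have := r' _ ma.
by have := proj1 ma _ _ px; have := proj1 ma _ _ qy; lia.
Qed.

Lemma partner_out q : F q -> q \notin C.
Proof.
by move=> [p [pC _] /rigid_sym r]; apply: contra pC; apply: C_closed r.
Qed.

(** [F] together with the side of [x0] in [C] is independent, so some minimal
    1-cover [a] vanishes on it.  As [a] vanishes on [F], it takes the value 1 on the
    boundary [N]; hence no edge leaving [C] constrains the values inside, and [a] can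
    be complemented on [C] while every vertex keeps its tight rigid edge. *)
Lemma flip_component x0 : x0 \in C ->
  exists a a' : {ffun T -> nat}, [/\ mincov G 1 a, mincov G 1 a',
    forall x, x \notin C -> a x = a' x &
    forall x, x \in C -> (a x + a' x = 1)%N].
Proof.
move=> x0C; pose E := [pred x | `[< F x \/ x \in C /\ same_value x x0 >]].
have partner_nadj q x : F q -> x \in C -> ~ adj G q x.
  move=> [p Np r] xC qx; apply: (boundary_partner Np r).
  by split; [apply: partner_out; exists p | exists x].
have [u v|a [ma a0]] := @mincov_avoid T G E.
  rewrite !inE => /asboolP uE /asboolP vE; apply/negP => uv.
  case: uE vE => [Fu|[uC su]] [Fv|[vC sv]].
  - have [p [pC [x xC px]] r] := Fu; have [p' Np' r'] := Fv.
    apply: (boundary_partner Np' r'); split; first exact: partner_out.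
    by exists x => //; rewrite adj_sym; apply: rigid_square r px uv.
  - exact: partner_nadj Fu vC uv.
  - by apply: (partner_nadj _ _ Fv uC); rewrite adj_sym.
  - by apply: same_nadj uv => b mb; rewrite su ?sv.
have N_one v : N v -> a v = 1%N.
  move=> Nv; have [q r] := nbr v; have := r _ ma.
  by rewrite (a0 q) ?addn0 // inE; apply/asboolP; left; exists v.
have le1 i := mincov_le i ma.
exists a, [ffun x => if x \in C then 1 - a x else a x]%N; split=> //; last 2 first.
- by move=> x /negbTE xC; rewrite ffunE xC.
- by move=> x xC; rewrite ffunE xC; have := le1 x; lia.
split=> [u v uv|i _].
  rewrite !ffunE; case: ifPn => uC; case: ifPn => vC.
  - case: (C_par uC vC) => [/same_nadj //|/(_ _ ma)].
    by have := le1 u; have := le1 v; lia.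
  - rewrite [a v]N_one; first lia.
    by split=> //; exists u; rewrite // adj_sym.
  - by rewrite [a u]N_one //; split=> //; exists v.
  - exact: (proj1 ma).
have [j r] := nbr i; exists j; first exact: rigid_adj.
have Eij : (j \in C) = (i \in C).
  by apply/idP/idP; apply: C_closed => //; apply: rigid_sym.
rewrite !ffunE Eij; have := r _ ma; have := le1 i; have := le1 j.
by case: ifP => _; lia.
Qed.

End Flip.
End Rigidity.

(** * Sums of minimal covers *)

Section Additivity.
Variables (T : finType) (G : sgraph T).
Implicit Types x y : T.

(** The combinatorial form of being a domain, in all degrees at once; this is
    what multiplication in the fiber cone sees. *)
Definition mincov_additive : Prop :=
  forall k l (a b : {ffun T -> nat}),
    mincov G k a -> mincov G l b -> mincov G (k + l) (a + b).

Lemma mincov0 : mincov G 0 (0 : {ffun T -> nat}).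
Proof. by split=> // i; rewrite ffunE. Qed.

Lemma mincov_sum (I : finType) (F : I -> {ffun T -> nat}) k :
  mincov_additive -> (forall i, mincov G k (F i)) ->
  mincov G (#|I| * k) (\sum_i F i).
Proof.
move=> add mF; rewrite -sum_nat_const.
by apply: (big_ind2 (fun (a : {ffun T -> nat}) l => mincov G l a)) => [|a k1 b k2|i _];
  [exact: mincov0 | exact: add | exact: mF].
Qed.

Lemma mincov_decomp k (a : {ffun T -> nat}) : mincov G k a ->
  exists s t : seq {ffun T -> nat},
    [/\ forall b, b \in s -> mincov G 1 b, forall b, b \in t -> mincov G 2 b,
        k = (size s + 2 * size t)%N & a = \sum_(b <- s) b + \sum_(b <- t) b].
Proof.
have [m] := ubnP k; elim: m k a => // m IH [|[|k]] a lt_km ma.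
- exists [::], [::]; split=> //; apply/ffunP => i; rewrite !big_nil addr0 ffunE.
  by apply/eqP; rewrite -leqn0; apply: (mincov_le _ ma).
- exists [:: a], [::]; split=> //; last by rewrite big_seq1 big_nil addr0.
  by move=> b; rewrite inE => /eqP ->.
have [b [c [Cb Cc E]]] := cov_split (proj1 ma).
have mb : mincov G 2 b.
  by apply: (mincov_addl (l := k) (b := c)) => //; apply: mincov_ext ma.
have mc : mincov G k c.
  apply: (mincov_addl (l := 2) (b := b)) => //; rewrite addn2.
  by apply: mincov_ext ma => i; rewrite E addnC.
have [|s [t [ms mt kE cE]]] := IH k c _ mc; first lia.
exists s, (b :: t); split=> //= [u|| ]; rewrite ?inE.
- by case/predU1P => [->|/mt].
- by rewrite kE; lia.
rewrite big_cons addrCA -cE; apply/ffunP => i; rewrite ffun_addE; exact: E.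
Qed.

(** Scaling a minimal 1-cover shows that the common norm in degree [k] is
    [k] times the one in degree 1.  So a sum of minimal covers has the same norm as
    any minimal cover below it, and therefore equals it. *)
Lemma constant_norm_additive :
  (forall k (a b : {ffun T -> nat}), (0 < k)%N -> mincov G k a -> mincov G k b ->
     norm_cover a = norm_cover b) ->
  mincov_additive.
Proof.
move=> H; have [c [mc _]] : exists c : {ffun T -> nat}, mincov G 1 c /\ {in pred0, forall x, c x = 0%N}.
  exact: mincov_avoid.
have normE k (a : {ffun T -> nat}) : mincov G k a -> norm_cover a = (k * norm_cover c)%N.
  case: k => [|k] ma.
    rewrite /norm_cover big1 // => i _.
    by apply/eqP; rewrite -leqn0; apply: (mincov_le _ ma).
  rewrite (H _ _ [ffun i => k.+1 * c i]%N _ ma) //.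
    by rewrite /norm_cover big_distrr /=; apply: eq_bigr => i _; rewrite ffunE.
  by apply: mincov_ext (mincov_scale k.+1 mc) => i; rewrite ffunE.
move=> k l a b ma mb; have Cab : cov G (k + l) (a + b).
  move=> i j ij; rewrite !ffun_addE.
  exact: (covD (proj1 ma) (proj1 mb) ij).
have [d [md le_d]] := cov_has_mincov Cab.
suff E : d =1 a + b by apply: mincov_ext md.
move=> i; apply/eqP; rewrite eqn_leq le_d /= leqNgt; apply/negP => lt.
have : (norm_cover d < norm_cover (a + b)%R)%N.
  rewrite /norm_cover (bigD1 i) //= [X in (_ < X)%N](bigD1 i) //= -addSn.
  by apply: leq_add => //; apply: leq_sum => j _.
by rewrite norm_addE (normE _ _ md) (normE _ _ ma) (normE _ _ mb); lia.
Qed.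

Section NoIsolatedVertex.
Hypothesis noiso : forall i, ~~ isolated G i.
Hypothesis T_gt0 : (0 < #|T|)%N.

Lemma domain_graph_additive : domain_graph G <-> mincov_additive.
Proof.
split=> [dG k l a b|add s t a b st0 ba bb]; last first.
  have st : (0 < s + 2 * t)%N by case: s t st0 {a ba b bb} => [|s] [].
  apply/basic_mincov => //; apply: (add).
    have ma i : mincov G 1 (a i) by apply/basic_mincov.
    by have := mincov_sum add ma; rewrite card_ord muln1.
  have mb i : mincov G 2 (b i) by apply/basic_mincov.
  by have := mincov_sum add mb; rewrite card_ord mulnC.
move=> /mincov_decomp[s [t [ms mt kE aE]]] /mincov_decomp[s' [t' [ms' mt' lE bE]]].
have -> : a + b = \sum_(c <- s ++ s') c + \sum_(c <- t ++ t') c.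
  by rewrite aE bE !big_cat /= addrACA.
have -> : (k + l = size (s ++ s') + 2 * size (t ++ t'))%N.
  by rewrite !size_cat kE lE; lia.
have {}ms c : c \in s ++ s' -> mincov G 1 c by rewrite mem_cat => /orP[/ms|/ms'].
have {}mt c : c \in t ++ t' -> mincov G 2 c by rewrite mem_cat => /orP[/mt|/mt'].
move: (s ++ s') (t ++ t') ms mt => {aE bE kE lE ms' mt' a b k l s' t'}u v mu mv.
have [/andP[/nilP -> /nilP ->]|uv0] := boolP ((size u == 0) && (size v == 0))%N.
  by rewrite !big_nil addr0; apply: mincov0.
apply/basic_mincov => //; first by case: (size u) (size v) uv0 => [|?] [].
rewrite [X in basic_kcover _ _ (X + _)](big_nth 0) big_mkord.
rewrite [X in basic_kcover _ _ (_ + X)](big_nth 0) big_mkord.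
apply: (dG _ _ (fun i => nth 0 u i) (fun i => nth 0 v i)) => // i.
  by apply/basic_mincov => //; apply/mu/mem_nth.
by apply/basic_mincov => //; apply/mv/mem_nth.
Qed.

(** If [x] had no rigid partner, pick for every [y] a minimal 1-cover that is
    not tight on the pair [x], [y].  In their sum no edge at [x] is tight, although the
    value at [x] is positive. *)
Lemma additive_rigid x : mincov_additive -> exists y, rigid G x y.
Proof.
move=> add; apply/not_existsP => nr.
have /choice[F FP] y : exists a : {ffun T -> nat}, mincov G 1 a /\ (a x + a y <> 1)%N.
  by have /existsNP[a /not_implyP[ma E]] := nr y; exists a.
have F_tight y : adj G x y -> (2 <= F y x + F y y)%N.
  by have [[Ca _] E] := FP y => /Ca; lia.
have sumFE z : (\sum_y F y) z = (\sum_y F y z)%N.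
  by apply: (big_morph (fun a : {ffun T -> nat} => a z)) => [a b|];
    rewrite ?ffun_addE ?ffunE.
have [_ /(_ x)[|y xy]] := mincov_sum add (fun y => proj1 (FP y)).
  (* Excess on an edge means value 1 at both ends, so the sum is positive at x. *)
  have /forallPn[y /negPn xy] := noiso x.
  have := F_tight _ xy; have := mincov_le y (proj1 (FP y)).
  by rewrite sumFE (bigD1 y) //=; lia.
rewrite !sumFE -big_split /= (bigD1 y) //= muln1 => E.
have : (#|T|.-1 <= \sum_(i | i != y) (F i x + F i y))%N.
  rewrite -(cardC1 y) -sum1_card; apply: leq_sum => i _.
  by have [[Ca _] _] := FP i; apply: Ca.
by rewrite -E; have := F_tight _ xy; lia.
Qed.

End NoIsolatedVertex.
End Additivity.

(** * Matchings as involutions *)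

Section Matchings.
Variables (T : finType) (G : sgraph T).

Lemma matching_involution M : perfect_matching G M ->
  exists2 f : T -> T, involutive f &
    (forall x, adj G x (f x)) /\ (forall x, [set x; f x] \in M).
Proof.
move=> /andP[/subsetP sME /and3P[/eqP covM trivM _]].
have /choice[f fP] x : exists y, adj G x y /\ [set x; y] \in M.
  have : x \in cover M by rewrite covM inE.
  case/bigcupP => B BM xB; have /imsetP[[p q] pq BE] := sME _ BM.
  rewrite /= inE in pq; rewrite /= in BE.
  move: xB; rewrite BE !inE => /pred2P[] ->; first by exists q; rewrite -BE.
  by exists p; rewrite adj_sym setUC -BE.
exists f; last by split=> x; have [] := fP x.
move=> x; have [fx1 fx2] := fP x; have [fy1 fy2] := fP (f x).
have E : [set x; f x] = [set f x; f (f x)].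
  apply: contraTeq (trivM) => nE; apply/negP => /trivIsetP /(_ _ _ fx2 fy2 nE).
  by rewrite disjoints_subset => /subsetP /(_ (f x)); rewrite !inE eqxx orbT => /(_ isT).
have : f (f x) \in [set x; f x] by rewrite E !inE eqxx orbT.
by rewrite !inE => /pred2P[] // E'; rewrite E' adj_irrefl in fy1.
Qed.

Lemma involution_matching (f : T -> T) :
  involutive f -> (forall x, adj G x (f x)) ->
  exists2 M, perfect_matching G M & forall x y, [set x; y] \in M -> y = f x.
Proof.
move=> fK fadj.
have pairE u z : (z == u) || (z == f u) -> [set u; f u] = [set z; f z].
  by case/orP => /eqP ->; rewrite // fK setUC.
exists [set [set x; f x] | x : T].
  apply/andP; split.
    apply/subsetP => B /imsetP[x _ ->]; apply/imsetP; exists (x, f x) => //.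
    by rewrite inE.
  apply/and3P; split.
  - apply/eqP/setP => x; rewrite inE; apply/bigcupP.
    by exists [set x; f x]; [apply: imset_f | rewrite !inE eqxx].
  - apply/trivIsetP => A B /imsetP[x _ ->] /imsetP[y _ ->] nE.
    rewrite disjoints_subset; apply/subsetP => z; rewrite !inE => zx.
    apply: contra nE => zy.
    by rewrite (pairE _ _ zx) (pairE _ _ zy).
  - by apply/imsetP => -[x _] /setP /(_ x); rewrite !inE eqxx.
move=> x y /imsetP[z _ E].
have {E} E : [set x; y] = [set x; f x] by rewrite E (pairE z x) // -in_set2 -E !inE eqxx.
have : f x \in [set x; y] by rewrite E !inE eqxx orbT.
by rewrite !inE => /pred2P[] // E'; have := fadj x; rewrite E' adj_irrefl.
Qed.

End Matchings.

Lemma eq_half_rat (p q : nat) : (p%:R = q%:R / 2%:R :> rat) <-> (p * 2 = q)%N.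
Proof.
have two : 2%:R != 0 :> rat by [].
split=> [E|<-]; last by rewrite natrM mulfK.
by apply/eqP; rewrite -(Num.Theory.eqr_nat rat) natrM E divfK //.
Qed.

Lemma involution_norm (T : finType) (f : T -> T) (a : {ffun T -> nat}) k :
  involutive f -> (forall x, (a x + a (f x))%N = k) ->
  (norm_cover a * 2 = k * #|T|)%N.
Proof.
move=> fK E; rewrite muln2 -addnn {2}/norm_cover (reindex_inj (inv_inj fK)).
by rewrite -big_split /= (eq_bigr _ (fun x _ => E x)) sum_nat_const mulnC.
Qed.

(** On a component with sides [A] and [B] the partner of a vertex is the vertex
    with the same rank on the other side.  Sides are chosen at the root of each
    component, so that all its vertices refer to the same choice. *)
Lemma balanced_matching (W : finType) (H : sgraph W) :
  (forall x, exists2 m : nat, (0 < m)%N &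
    complete_bipartite_on H (component H x) m m) ->
  has_perfect_matching H.
Proof.
move=> bal; have sym : connect_sym (adj H) := sym_connect_sym (adj_sym H).
have /choice[g gP] x : exists AB : {set W} * {set W},
    [/\ AB.1 :|: AB.2 = component H x, [disjoint AB.1 & AB.2], #|AB.1| = #|AB.2|
      & {in component H x &, forall y z,
           adj H y z = (y \in AB.1) && (z \in AB.2) || (y \in AB.2) && (z \in AB.1)}].
  by have [m _ [A [B [UAB dAB cA cB adjE]]]] := bal x; exists (A, B); rewrite /= cA cB.
pose A x := (g (fingraph.root (adj H) x)).1; pose B x := (g (fingraph.root (adj H) x)).2.
have compE x : component H (fingraph.root (adj H) x) = component H x.
  by apply/setP => y; rewrite !inE; apply/esym/(same_connect sym)/connect_root.
have UAB x : A x :|: B x = component H x by have [-> _ _ _] := gP (fingraph.root (adj H) x).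
have dAB x : [disjoint A x & B x] by have [] := gP (fingraph.root (adj H) x).
have cAB x : #|A x| = #|B x| by have [] := gP (fingraph.root (adj H) x).
have adjE x y z : y \in component H x -> z \in component H x ->
    adj H y z = (y \in A x) && (z \in B x) || (y \in B x) && (z \in A x).
  by have [_ _ _] := gP (fingraph.root (adj H) x); rewrite compE; apply.
have inAB x : (x \in A x) || (x \in B x) by rewrite -in_setU UAB inE connect0.
pose f x := if x \in A x then nth x (enum (B x)) (index x (enum (A x)))
            else nth x (enum (A x)) (index x (enum (B x))).
have nthP (X Y : {set W}) x : #|X| = #|Y| -> x \in X -> nth x (enum Y) (index x (enum X)) \in Y.
  move=> XY xX; rewrite -mem_enum mem_nth // -cardE -XY cardE.
  by rewrite index_mem mem_enum.
have f_side x : (x \in A x) && (f x \in B x) || (x \in B x) && (f x \in A x).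
  rewrite /f; have := inAB x; case: ifP => /= [xA _|_ xB]; first by rewrite nthP.
  by rewrite xB nthP // cAB.
have f_comp x : f x \in component H x.
  by rewrite -UAB inE; case/orP: (f_side x) => /andP[_ ->]; rewrite ?orbT.
have fadj x : adj H x (f x).
  by rewrite (adjE x) // inE connect0.
have rootE x : fingraph.root (adj H) (f x) = fingraph.root (adj H) x.
  by apply/esym/(fingraph.rootP sym); have := f_comp x; rewrite inE.
have AfE x : A (f x) = A x by rewrite /A rootE.
have BfE x : B (f x) = B x by rewrite /B rootE.
have nA x : x \in B x -> x \in A x = false.
  by move=> xB; apply/negP => xA; have /disjointFr/(_ xA) := dAB x; rewrite xB.
have f_A x : x \in A x -> f x = nth x (enum (B x)) (index x (enum (A x))).
  by rewrite /f => ->.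
have f_B x : x \in B x -> f x = nth x (enum (A x)) (index x (enum (B x))).
  by rewrite /f => /nA ->.
have idx (X Y : {set W}) d d' x : #|X| = #|Y| -> x \in X ->
    nth d (enum X) (index (nth d' (enum Y) (index x (enum X))) (enum Y)) = x.
  move=> XY xX; have lt : (index x (enum X) < size (enum Y))%N.
    by rewrite -cardE -XY cardE index_mem mem_enum.
  by rewrite index_uniq ?enum_uniq ?nth_index ?mem_enum.
have fK : involutive f.
  move=> x; case/orP: (f_side x) => /andP[xX fxY].
    by rewrite f_B ?BfE // AfE f_A // idx.
  by rewrite f_A ?AfE // BfE f_B // idx.
by have [M pM _] := involution_matching fK fadj; exists M.
Qed.

(** Suppose that the matching edge [x], [f x] is not tight.  Then both ends have
    positive value, hence tight edges to some [x'] and [y'], and adding up the values on the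
    edge [x'], [y'] contradicts the excess on [x], [f x]. *)
Lemma matched_square_norm (T : finType) (G : sgraph T) k (f : T -> T) (a : {ffun T -> nat}) :
  involutive f ->
  (forall x, adj G x (f x)) ->
  (forall x x' y', adj G x x' -> adj G (f x) y' -> adj G x' y') ->
  mincov G k a -> (norm_cover a * 2 = k * #|T|)%N.
Proof.
move=> fK fadj sq [Ca ta]; apply: (involution_norm fK) => x.
apply/eqP; rewrite eqn_leq Ca // andbT leqNgt; apply/negP => lt.
have [ax|/ta[x' xx E]] := posnP (a x).
  have /ta[y' yy E'] : (0 < a (f x))%N by lia.
  by lia.
have [ay|/ta[y' yy E']] := posnP (a (f x)); first by lia.
by have := Ca _ _ (sq _ _ _ xx yy); lia.
Qed.

(** * The graph G^{0-1} of a graph without isolated vertices *)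

Section NonIsolated.
Variables (T : finType) (G : sgraph T).
Hypothesis noiso : forall i, ~~ isolated G i.
Hypothesis T_gt0 : (0 < #|T|)%N.
Local Notation V := (red_vertex G).
Implicit Types (x y : T) (u v : V).

Let r x : V := exist _ x (noiso x).
Let val_r x : val (r x) = x. Proof. by []. Qed.
Let r_val u : r (val u) = u. Proof. exact: val_inj. Qed.

Lemma adj01_rigid u v : adj01 u v <-> rigid G (val u) (val v).
Proof.
split=> [/andP[_ /asboolP H] a ma|R].
  by apply: H; apply/basic_mincov.
rewrite /adj01 rigid_adj //=; apply/asboolP => a /basic_mincov H.
by apply/R/H.
Qed.

Lemma MSC_norm k (a : {ffun T -> nat}) :
  MSC G -> mincov G k a -> (norm_cover a * 2 = k * #|T|)%N.
Proof.
move=> [_ [M [/matching_involution[f fK [fadj fM]] sq]]].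
apply: (matched_square_norm (f := fun x => val (f (r x)))) => [x|x|x x' y'].
- by rewrite r_val fK.
- exact: (fadj (r x)).
- by apply: (sq (r x) (f (r x))).
Qed.

Lemma rigid_MSC (f : T -> T) : involutive f -> (forall x, rigid G x (f x)) -> MSC G.
Proof.
move=> fK fr; split; first by have /card_gt0P[x _] := T_gt0; apply/card_gt0P; exists (r x).
have [u|u|M pM ME] := @involution_matching _ (red_graph G) (fun u => r (f (val u))).
- by apply: val_inj; rewrite /= fK.
- exact: (rigid_adj (fr (val u))).
exists M; split=> // u v /ME -> i j; exact: (rigid_square (fr (val u))).
Qed.

Lemma matching01 : has_perfect_matching (graph01 G) ->
  has_perfect_matching G /\
  forall a : {ffun T -> nat}, mincov G 1 a -> (num_ones a * 2 = #|T|)%N.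
Proof.
move=> [M /matching_involution[f fK [fadj _]]].
pose g x := val (f (r x)).
have gK : involutive g by move=> x; rewrite /g r_val fK.
have gr x : rigid G x (g x) by apply: (proj1 (adj01_rigid (r x) (f (r x)))); apply: fadj.
split.
  by have [M' pM _] := involution_matching gK (fun x => rigid_adj (gr x)); exists M'.
move=> a ma; rewrite (num_ones_norm ma) -[RHS]mul1n.
by apply: (involution_norm gK) => x; apply: gr.
Qed.

(** Every matching edge has value at least 1 and the total is half the number of
    vertices, so every matching edge is rigid. *)
Lemma matching_half_MSC : has_perfect_matching G ->
  (forall a : {ffun T -> nat}, mincov G 1 a -> (num_ones a * 2 = #|T|)%N) -> MSC G.
Proof.
move=> [M /matching_involution[f fK [fadj _]]] half.
apply: (rigid_MSC fK) => x a ma; have [Ca _] := ma.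
apply/eqP; rewrite eqn_leq Ca // andbT leqNgt; apply/negP => lt.
have := half _ ma; rewrite (num_ones_norm ma) muln2 -addnn {2}/norm_cover.
rewrite (reindex_inj (inv_inj fK)) -big_split /= (bigD1 x) //= => E.
have : (#|T|.-1 <= \sum_(i | i != x) (a i + a (f i)))%N.
  by rewrite -(cardC1 x) -sum1_card; apply: leq_sum => i _; apply: Ca.
by rewrite -E; lia.
Qed.

Lemma component_parity u v : connect (adj (graph01 G)) u v ->
  same_value G (val u) (val v) \/ rigid G (val u) (val v).
Proof.
case/connectP => p; elim: p u => [|w p IH] u /=.
  by move=> _ ->; left.
case/andP => /adj01_rigid uw /IH + vE => /(_ vE) [s|s]; [right|left] => a ma;
  move: (uw _ ma) (s _ ma); move: (a (val u)) (a (val v)) (a (val w)); lia.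
Qed.

(** Walks in G^{0-1} have a parity, so rigid pairs in a component are exactly the
    pairs with opposite values in the cover [a] given by [flip_component].  That [a] and
    its flipped version have the same number of ones says that the sides have equal size. *)
Lemma component_balanced : mincov_additive G -> unmixed_graph G ->
  forall u, exists2 m : nat, (0 < m)%N &
    complete_bipartite_on (graph01 G) (component (graph01 G) u) m m.
Proof.
move=> add unm u; have sym : connect_sym (adj (graph01 G)).
  exact: (sym_connect_sym (adj_sym (graph01 G))).
set C := component _ u.
have inC v : (v \in C) = connect (adj (graph01 G)) u v by rewrite inE.
have par v w : v \in C -> w \in C -> same_value G (val v) (val w) \/ rigid G (val v) (val w).
  rewrite !inC => uv uw; apply: component_parity.
  by apply: connect_trans uw; rewrite sym.
have uC : u \in C by rewrite inC connect0.
have valC v : (val v \in val @: C) = (v \in C) by apply: mem_imset; apply: val_inj.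
have [|x y|x y||a [a' [ma ma' aE aC]]] :=
    @flip_component T G _ (val @: C) _ _ (val u).
- by move=> x; apply: additive_rigid.
- move=> xy; rewrite -(val_r x) -(val_r y) !valC !inC => ux.
  by apply: connect_trans ux _; apply/connect1/adj01_rigid.
- by rewrite -(val_r x) -(val_r y) !valC; apply: par.
- by rewrite valC.
have aV v : v \in C -> (a (val v) + a' (val v) = 1)%N by move=> vC; apply: aC; rewrite valC.
pose A := [set v in C | a (val v) == 1%N]; pose B := [set v in C | a (val v) == 0%N].
have cardA : #|A| = (\sum_(x in val @: C) a x)%N.
  rewrite big_imset /=; last by move=> ? ? _ _; apply: val_inj.
  rewrite -sum1_card [RHS](bigID (fun v => a (val v) == 1%N)) /= [X in (_ + X)%N]big1 ?addn0.
    by rewrite big_set /=; apply: eq_bigr => v /andP[_ /eqP].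
  by move=> v /andP[/aV]; case: (a (val v)) => [|[]].
have cardB : #|B| = (\sum_(x in val @: C) a' x)%N.
  rewrite big_imset /=; last by move=> ? ? _ _; apply: val_inj.
  rewrite -sum1_card [RHS](bigID (fun v => a (val v) == 0%N)) /= [X in (_ + X)%N]big1 ?addn0.
    by rewrite big_set /=; apply: eq_bigr => v /andP[/aV + /eqP E]; rewrite E.
  by move=> v /andP[/aV]; case: (a (val v)) => // m [] /eqP; rewrite addn_eq0 => /andP[_ /eqP].
have AB : #|A| = #|B|.
  have : norm_cover a = norm_cover a'.
    by rewrite -(num_ones_norm ma) -(num_ones_norm ma'); apply: unm; apply/basic_mincov.
  rewrite /norm_cover (bigID (mem (val @: C))) /= [RHS](bigID (mem (val @: C))) /=.
  by rewrite (eq_bigr _ aE) -cardA -cardB => /eqP; rewrite eqn_add2r => /eqP.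
exists #|A|.
  have : (0 < #|A| + #|B|)%N.
    rewrite addn_gt0; apply/orP; have := aV _ uC.
    case E : (a (val u)) => [|[|]] // _; last by left; apply/card_gt0P; exists u; rewrite inE uC E.
    by right; apply/card_gt0P; exists u; rewrite inE uC E.
  by rewrite -AB addnn; case: #|A|.
exists A, B; split=> //.
- apply/setP => v; rewrite !inE -andb_orr -inC; case vC: (v \in C) => //=.
  by have := aV _ vC; case: (a _) => [|[]].
- rewrite disjoints_subset; apply/subsetP => v; rewrite !inE => /andP[_ /eqP ->].
  by rewrite andbF.
move=> v w vC wC; rewrite !inE -!inC vC wC /=; apply/idP/idP.
  move=> /adj01_rigid /(_ _ ma).
  by case: (a (val v)) (a (val w)) => [|[|?]] [|[|?]].
case: (par _ _ vC wC) => [/(_ _ ma) ->|R _]; last exact/adj01_rigid.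
by case: (a (val w)) => [|[]].
Qed.

End NonIsolated.

(** * Ideals, primes and powers *)

Section GeneralIdeals.
Variable R : comNzRingType.
Implicit Types (I P E : R -> Prop).

Lemma ideal_gen_sub E I : is_ideal I -> (forall x, E x -> I x) ->
  forall x, ideal_gen E x -> I x.
Proof.
move=> [I0 ID IM] EI x [m [c [g [Eg ->]]]].
by apply: (big_ind I) => // i _; apply/IM/EI.
Qed.

Lemma ideal_gen_mem E x : E x -> ideal_gen E x.
Proof.
move=> Ex; exists 1%N, (fun _ => 1), (fun _ => x).
by split=> //; rewrite big_ord1 mul1r.
Qed.

Lemma ideal_pow_expr I x k : I x -> ideal_pow I k (x ^+ k).
Proof.
move=> Ix; apply: ideal_gen_mem; exists (fun _ => x); split=> //.
by rewrite big_const_ord iter_mulr_1.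
Qed.

Lemma prime_ideal_prod P (I : finType) (F : I -> R) :
  prime_ideal P -> (forall i, ~ P (F i)) -> ~ P (\prod_i F i).
Proof.
move=> [_ P1 PM] nF; apply: (big_ind (fun x => ~ P x)) => // x y nx ny.
by case/PM.
Qed.

Lemma prime_ideal_expr P x k : prime_ideal P -> ~ P x -> ~ P (x ^+ k).
Proof.
move=> [_ P1 PM] nx; elim: k => [|k IH]; first by rewrite expr0.
by rewrite exprS => /PM [].
Qed.

End GeneralIdeals.

(** * Monomial primes and their intersections *)

Section MonomialPrimes.
Variables (n : nat) (K : fieldType).
Local Notation S := {mpoly K[n]}.
Implicit Types (f g s : S) (m : 'X_{1..n}) (C D : {set 'I_n}).

Lemma msupp_sumP (I : finType) (F : I -> S) m :
  m \in msupp (\sum_i F i) -> exists i, m \in msupp (F i).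
Proof.
rewrite mcoeff_msupp => nz; apply: contrapT => /forallNP H.
case/eqP: nz; rewrite raddf_sum big1 //= => i _; apply/eqP.
by rewrite mcoeff_eq0; apply/negP/H.
Qed.

Lemma msuppMP f g m : m \in msupp (f * g) ->
  exists m1 m2, [/\ m1 \in msupp f, m2 \in msupp g & m = (m1 + m2)%MM].
Proof. by move/msuppM_le/allpairsP => [[m1 m2] /= [? ? ->]]; exists m1, m2. Qed.

Lemma ideal_of_monomials (I : S -> Prop) f : is_ideal I ->
  (forall m, m \in msupp f -> I 'X_[m]) -> I f.
Proof.
move=> [I0 ID IM] H; rewrite (mpolyE f) big_seq.
by apply: (big_ind I) => // m /H; rewrite -mul_mpolyC; apply: IM.
Qed.

Lemma monomial_ideal_mem (U : 'X_{1..n} -> Prop) f :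
  ideal_gen (fun g => exists2 u, U u & g = 'X_[u]) f <->
  (forall m, m \in msupp f -> exists2 u, U u & (u <= m)%MM).
Proof.
split=> [[l [c [g [Ug ->]]]] m /msupp_sumP[i]|H].
  have [u Uu ->] := Ug i; case/msuppMP => m1 [m2 [_]].
  rewrite msuppX inE => /eqP -> ->; exists u => //; exact: lem_addl.
have iI := ideal_gen_is_ideal (fun g : S => exists2 u, U u & g = 'X_[u]).
apply: (ideal_of_monomials iI) => m /H[u Uu um]; have [_ _ IM] := iI.
rewrite -(submK um) mpolyXD; apply/IM/ideal_gen_mem; by exists u.
Qed.

Definition degree_on C m : nat := \sum_(i in C) m i.

(** The [k]-th power of the prime generated by the variables in [C], described
    by the order of vanishing along it. *)
Definition order_on_ge C k f : Prop :=
  forall m, m \in msupp f -> (k <= degree_on C m)%N.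

Definition monomial_prime C : S -> Prop := order_on_ge C 1.

Lemma degree_onD C m1 m2 :
  degree_on C (m1 + m2)%MM = (degree_on C m1 + degree_on C m2)%N.
Proof. by rewrite /degree_on -big_split /=; apply: eq_bigr => i _; rewrite mnmDE. Qed.

Lemma degree_on_gt0 C m : (0 < degree_on C m)%N <-> exists2 i, i \in C & (0 < m i)%N.
Proof.
rewrite lt0n /degree_on sum_nat_eq0; split.
  by case/forall_inPn => i iC; rewrite -lt0n; exists i.
by case=> i iC mi; apply/forall_inPn; exists i; rewrite // -lt0n.
Qed.

Lemma order_on_ge_ideal C k : is_ideal (order_on_ge C k).
Proof.
split=> [m|f g Hf Hg m|a f Hf m]; first by rewrite msupp0.
  by move/msuppD_le; rewrite mem_cat => /orP[/Hf|/Hg].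
by case/msuppMP => m1 [m2 [_ /Hf + ->]]; rewrite degree_onD; lia.
Qed.

Lemma order_on_geM C k l f g : order_on_ge C k f -> order_on_ge C l g ->
  order_on_ge C (k + l) (f * g).
Proof.
move=> Hf Hg m /msuppMP[m1 [m2 [/Hf + /Hg + ->]]]; rewrite degree_onD; lia.
Qed.

Lemma order_on_geX C k m : order_on_ge C k 'X_[m] <-> (k <= degree_on C m)%N.
Proof.
split=> [/(_ m)|H m']; first by rewrite msuppX inE eqxx; apply.
by rewrite msuppX inE => /eqP ->.
Qed.

(** Multiplies the variables in [C] by an auxiliary variable, so that the order
    along [C] becomes the order of a univariate polynomial over a domain. *)
Definition grade C : S -> {poly S} :=
  mmap (@polyC S \o @mpolyC n K)
    (fun i => ('X_i)%:P * (if i \in C then 'X else 1)).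

Lemma gradeX C m : grade C 'X_[m] = ('X_[m])%:P * 'X^(degree_on C m).
Proof.
rewrite /grade mmapX /mmap1 (eq_bigr (fun i => (('X_i)^+ m i)%:P * (if i \in C then 'X^(m i) else 1))).
  rewrite big_split /= -big_mkcond /= prodrXr; congr (_ * _).
  by rewrite [X in _ = X%:P]mpolyXE_id rmorph_prod.
by move=> i _; rewrite exprMn -polyC_exp; case: ifP; rewrite ?expr1n.
Qed.

Lemma gradeM C f g : grade C (f * g) = grade C f * grade C g.
Proof. exact: rmorphM. Qed.

Lemma coef_grade C f d m :
  ((grade C f)`_d)@_m = if degree_on C m == d then f@_m else 0.
Proof.
rewrite {1}(mpolyE f) /grade raddf_sum coef_sum raddf_sum /=.
rewrite (eq_bigr (fun m' => f@_m' * ((degree_on C m' == d) && (m' == m))%:R)).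
  case: (boolP (m \in msupp f)) => [mf|mf].
    rewrite (bigD1_seq m) //= eqxx andbT big1 ?addr0.
      by case: eqP; rewrite ?mulr1 ?mulr0.
    by move=> m' /negbTE ->; rewrite andbF mulr0.
  rewrite big_seq big1; first by move: mf; rewrite -mcoeff_eq0 => /eqP ->; case: ifP.
  move=> m' m'f; case: (eqVneq m' m) => [E|_]; last by rewrite andbF mulr0.
  by rewrite -E m'f in mf.
move=> m' _; rewrite mmapZ -/(grade C _) gradeX /= coefCM coefCM coefXn.
rewrite mcoeffCM; congr (_ * _); rewrite eq_sym; case: eqP => _ /=.
  by rewrite mulr1 mcoeffX.
by rewrite mulr0 mcoeff0.
Qed.

Lemma order_on_ge_coef C k f :
  order_on_ge C k f <-> forall d, (d < k)%N -> (grade C f)`_d = 0.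
Proof.
split=> [H d dk|H m mf].
  apply/mpolyP => m; rewrite coef_grade mcoeff0; case: eqP => // E.
  by apply/eqP; rewrite mcoeff_eq0; apply/negP => /H; rewrite E leqNgt dk.
rewrite leqNgt; apply/negP => /H /mpolyP /(_ m); rewrite coef_grade eqxx mcoeff0.
by apply/eqP; rewrite -mcoeff_msupp.
Qed.

(** The powers of a monomial prime are primary: the lowest coefficient of
    [grade C s] is nonzero, so it cannot raise the order of a product. *)
Lemma order_on_ge_cancel C k s f :
  ~ monomial_prime C s -> order_on_ge C k (s * f) -> order_on_ge C k f.
Proof.
move=> /order_on_ge_coef ns /order_on_ge_coef Hsf; apply/order_on_ge_coef.
have s0 : (grade C s)`_0 != 0.
  by apply/eqP => s0; apply: ns => -[|] // ; rewrite s0.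
move=> d; elim/ltn_ind: d => d IH dk; have := Hsf d dk.
rewrite gradeM coefM big_ord_recl subn0 big1 ?addr0.
  by move/eqP; rewrite mulf_eq0 (negbTE s0) => /eqP.
move=> i _; have lt : (d - lift ord0 i < d)%N by move: (ltn_ord i); rewrite lift0; lia.
by rewrite [X in _ * X](IH _ lt (ltn_trans lt dk)) mulr0.
Qed.

Lemma monomial_prime_prime C : prime_ideal (monomial_prime C).
Proof.
split; first exact: order_on_ge_ideal.
  by move/(_ 0%MM); rewrite msupp1 inE eqxx => /(_ isT) /degree_on_gt0[i _]; rewrite mnm0E.
move=> f g Hfg; case: (pselect (monomial_prime C f)) => [|nf]; [by left|right].
exact: order_on_ge_cancel nf Hfg.
Qed.

Lemma monomial_primeX C m :
  monomial_prime C 'X_[m] <-> exists2 i, i \in C & (0 < m i)%N.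
Proof. by rewrite -degree_on_gt0; exact: order_on_geX. Qed.

Lemma monomial_primeP C f : monomial_prime C f <->
  forall m, m \in msupp f -> exists2 i, i \in C & (0 < m i)%N.
Proof. by split=> H m /H /degree_on_gt0. Qed.

Lemma monomial_primeS C D f : C \subset D -> monomial_prime C f -> monomial_prime D f.
Proof.
by move=> /subsetP CD /monomial_primeP H; apply/monomial_primeP => m /H[i /CD]; exists i.
Qed.

(** The product of the variables outside [C], which separates the prime of [C]
    from those of the sets not contained in [C]. *)
Definition outside C : S := 'X_[[multinom (i \notin C : nat) | i < n]].

Lemma outside_prime C D : monomial_prime D (outside C) <-> ~ (D \subset C).
Proof.
rewrite monomial_primeX; split=> [[i iD]|/negP/subsetPn[i iD iC]].
  by rewrite mnmE => iC /subsetP /(_ _ iD) E; rewrite E in iC.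
by exists i; rewrite // mnmE iC.
Qed.

Section Intersection.
Variable F : {set {set 'I_n}}.
Definition prime_inter f : Prop := forall C, C \in F -> monomial_prime C f.

(** The annihilator of [f] modulo the intersection is the intersection of the
    primes that miss [f]; a prime equal to it contains, hence equals, one of them. *)
Lemma associated_prime_inter P : associated_prime prime_inter P ->
  exists2 C, C \in F & P = monomial_prime C.
Proof.
move=> [prP [f Pf]]; have [_ P1 _] := prP.
apply: contrapT => nex.
have /choice[r rP] C : exists r, (C \in F -> monomial_prime C (r * f)) /\ ~ P r.
  case: (pselect (monomial_prime C f)) => [Cf|nCf]; first by exists 1; rewrite mul1r.
  case CF: (C \in F); last by exists 1.
  apply: contrapT => /forallNP H; apply: nex; exists C => //.
  have [_ _ CM] := monomial_prime_prime C.
  apply/funext => r; apply/propext; split=> [/Pf /(_ _ CF) /CM [] //|Cr].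
  apply: contrapT => nPr; apply: (H r); split=> // _.
  by have [[_ _ IM] _ _] := monomial_prime_prime C; rewrite mulrC; apply: IM.
apply: (@prime_ideal_prod _ P _ r prP); first by move=> C; have [] := rP C.
apply/Pf => C CF; have [[_ _ IM] _ _] := monomial_prime_prime C.
rewrite (bigD1 C) //= mulrAC mulrC; apply: IM.
by have [H _] := rP C; apply: H.
Qed.

Lemma inter_associated_prime C : C \in F ->
  (forall D, D \in F -> D \subset C -> D = C) ->
  associated_prime prime_inter (monomial_prime C).
Proof.
move=> CF Cmin; split; first exact: monomial_prime_prime.
exists (outside C) => r; split=> [Cr D DF|/(_ _ CF)].
  case: (boolP (D \subset C)) => [/(Cmin _ DF) ->|/negP/outside_prime DC].
    by have [[_ _ IM] _ _] := monomial_prime_prime C; rewrite mulrC; apply: IM.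
  by have [[_ _ IM] _ _] := monomial_prime_prime D; apply: IM.
have [_ _ CM] := monomial_prime_prime C.
by case/CM => // /outside_prime; rewrite subxx.
Qed.

End Intersection.
End MonomialPrimes.

(** * Heights of monomial primes *)

Section ChainIndependence.
Variables (R : comNzRingType) (Q : nat -> R -> Prop) (h : nat) (y : nat -> R).
Hypothesis Q_prime : forall i, (i <= h)%N -> prime_ideal (Q i).
Hypothesis Q_incl : forall i, (i < h)%N -> forall x, Q i x -> Q i.+1 x.
Hypothesis y_in : forall i, (i < h)%N -> Q i.+1 (y i).
Hypothesis y_out : forall i, (i < h)%N -> ~ Q i (y i).
Variables (I : finType) (c c' : I -> R) (e : I -> nat -> nat).

(** Elements [y i] of [Q i.+1] outside [Q i] are algebraically independent.  In a
    relation in [y j], [y j.+1], and so on that lies in [Q j], divide by the largest power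
    of [y j] common to its terms, which is not in [Q j]; modulo [Q j.+1] only the terms free of [y j] survive,
    and they form a relation one step further up.  The last relation is a nonzero constant.
    The index type [I] with exponents [e] stands for the monomials of the relation. *)
Lemma chain_independent j (A : {set I}) : (j <= h)%N -> A != set0 ->
  {in A, forall a, c' a * c a = 1} ->
  {in A &, forall a b, (forall l, (j <= l < h)%N -> e a l = e b l) -> a = b} ->
  ~ Q j (\sum_(a in A) c a * \prod_(j <= l < h) y l ^+ e a l).
Proof.
move dE: (h - j)%N => d; elim: d j A dE => [|d IH] j A dE jh A0 cU inj.
  have jh' : j = h by lia.
  rewrite {j dE jh}jh' in inj *.
  have [a0 a0A] := set0Pn _ A0; have [[_ _ QM] Q1 _] := Q_prime (leqnn h).
  have -> : A = [set a0].
    apply/eqP; rewrite eq_sym eqEsubset sub1set a0A /=; apply/subsetP => a aA.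
    by rewrite inE; apply/eqP/inj => // l /andP[hl /(leq_ltn_trans hl)]; rewrite ltnn.
  by rewrite big_set1 big_geq // mulr1 => /(QM (c' a0)); rewrite cU.
have lt_jh : (j < h)%N by lia.
have [a0 a0A] := set0Pn _ A0.
pose am := [arg min_(a < a0 in A) e a j]; pose m := e am j.
have [amA am_min] : am \in A /\ forall a, a \in A -> (m <= e a j)%N.
  by rewrite /m /am; case: arg_minnP => // i iA Hi; split.
pose rest a := \prod_(j.+1 <= l < h) y l ^+ e a l.
have -> : \sum_(a in A) c a * \prod_(j <= l < h) y l ^+ e a l =
    y j ^+ m * \sum_(a in A) c a * (y j ^+ (e a j - m) * rest a).
  rewrite mulr_sumr; apply: eq_bigr => a aA.
  by rewrite big_ltn // [RHS]mulrCA; congr (_ * _); rewrite mulrA -exprD subnKC ?am_min.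
have prj := Q_prime jh; have [_ _ QPj] := prj.
case/QPj => [|/(Q_incl lt_jh)].
  by move: (prime_ideal_expr (k := m) prj (y_out lt_jh)).
have [[Q0 QD QM] _ _] := Q_prime lt_jh.
rewrite (big_setID [set a | e a j == m]) /=.
set s1 := \sum_(a in A :&: _) _; set s2 := \sum_(a in A :\: _) _ => Q12.
have Qs2 : Q j.+1 s2.
  apply: (big_ind (Q j.+1)) => // a; rewrite !inE => /andP[am_neq aA].
  apply: (QM); rewrite mulrC; apply: (QM).
  have -> : (e a j - m = (e a j - m).-1.+1)%N by have := am_min a aA; lia.
  by rewrite exprS mulrC; apply/QM/y_in.
have : Q j.+1 s1.
  by rewrite -[s1](addrK s2) -[- s2]mulN1r; apply: (QD) => //; apply: QM.
have -> : s1 = \sum_(a in A :&: [set a | e a j == m]) c a * rest a.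
  by apply: eq_bigr => a; rewrite !inE => /andP[_ /eqP ->]; rewrite subnn mul1r.
apply: IH => //; first lia.
- by apply/set0Pn; exists am; rewrite !inE amA eqxx.
- by move=> a; rewrite inE => /andP[aA _]; apply: cU.
move=> a b; rewrite !inE => /andP[aA /eqP am_a] /andP[bA /eqP bm] E.
apply: inj => // l /andP[]; rewrite leq_eqVlt => /predU1P[<- _|jl lh].
  by rewrite am_a bm.
by apply: E; rewrite jl lh.
Qed.

End ChainIndependence.

Section Dimension.
Variables (n : nat) (K : fieldType).
Local Notation S := {mpoly K[n]}.

Definition exponents_le d (f : S) : Prop :=
  forall m, m \in msupp f -> forall j, (m j <= d)%N.

Lemma exponents_le_prod (I : finType) (F : I -> S) (d : I -> nat) :
  (forall i, exponents_le (d i) (F i)) ->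
  exponents_le (\sum_i d i) (\prod_i F i).
Proof.
move=> H; apply: (big_ind2 (fun f k => exponents_le k f)) => // [m|f k g l Hf Hg m].
  by rewrite msupp1 inE => /eqP -> j; rewrite mnm0E.
by case/msuppMP => m1 [m2 [/Hf H1 /Hg H2 ->]] j; rewrite mnmDE leq_add.
Qed.

Lemma exponents_le_expr d (f : S) k :
  exponents_le d f -> exponents_le (k * d) (f ^+ k).
Proof.
move=> H; rewrite -[k in (k * d)%N]card_ord -sum_nat_const -[k in f ^+ k]card_ord -prodr_const.
exact: exponents_le_prod.
Qed.

Lemma exponents_le_bound (I : finType) (F : I -> S) :
  exists d, forall i, exponents_le d (F i).
Proof.
exists (\sum_i \sum_(m <- msupp (F i)) \sum_j m j)%N => i m mF j.
rewrite (bigD1 i) //= (bigD1_seq m) //= (bigD1 j) //= -!addnA; exact: leq_addr.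
Qed.

(** There are [N.+1 ^ n.+1] monomials in [y] with exponents at most [N], while they
    lie in a space of dimension [(N * B).+1 ^ n], which is smaller once [N] is large. *)
Lemma algebraic_dependence (y : 'I_n.+1 -> S) : exists N,
  exists2 c : {ffun {ffun 'I_n.+1 -> 'I_N.+1} -> K}, c != 0 &
    \sum_a c a *: \prod_i y i ^+ a i = 0.
Proof.
have [D yD] := exponents_le_bound y.
(* With this N, (N * B + 1) ^ n is at most ((N + 1) * (B + 1)) ^ n = (N + 1) ^ n * N. *)
pose B := (n.+1 * D)%N; pose N := ((B + 1) ^ n)%N; exists N.
pose I := {ffun 'I_n.+1 -> 'I_N.+1}; pose J := {ffun 'I_n -> 'I_(N * B).+1}.
pose p (a : I) := \prod_i y i ^+ a i.
have p_le a : exponents_le (N * B) (p a).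
  have := exponents_le_prod (fun i => exponents_le_expr (k := a i) (yD i)).
  move=> H m /H le j; apply: leq_trans (le j) _.
  rewrite -big_distrl /= mulnA [(N * _)%N]mulnC leq_mul2r; apply/orP; right.
  rewrite -[n.+1 in leqRHS]card_ord -sum_nat_const; apply: leq_sum => i _.
  by rewrite -ltnS ltn_ord.
have ltJI : (#|{: J}| < #|{: I}|)%N.
  rewrite !card_ffun !card_ord expnS.
  apply: leq_ltn_trans (_ : ((N.+1 * (B + 1)) ^ n < _)%N).
    by case: (posnP n) => [->//|n0]; rewrite leq_exp2r //; nia.
  by rewrite expnMn mulnC ltn_pmul2r // expn_gt0.
pose M : 'M[K]_(#|{: I}|, #|{: J}|) :=
  \matrix_(a, b) (p (enum_val a))@_[multinom ((enum_val b : J) i : nat) | i < n].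
have : kermx M != 0.
  by rewrite kermx_eq0 -row_leq_rank -ltnNge; apply: leq_ltn_trans ltJI; apply: rank_leq_col.
case/rowV0Pn => v /sub_kermxP vM v0.
exists [ffun a => v 0 (enum_rank a)].
  apply: contra v0 => /eqP/ffunP v0; apply/eqP/rowP => i.
  by have := v0 (enum_val i); rewrite !ffunE enum_valK mxE.
apply/mpolyP => m; rewrite mcoeff0 raddf_sum /=.
have [mB|/existsNP[j /negP jB]] := pselect (forall j, m j <= N * B)%N; last first.
  rewrite big1 // => a _; rewrite mcoeffZ; apply/eqP; rewrite mulf_eq0; apply/orP; right.
  by rewrite mcoeff_eq0; apply/negP => /p_le /(_ j); apply/negP.
pose b : J := [ffun j => inord (m j)].
have /rowP /(_ (enum_rank b)) := vM; rewrite !mxE => vM0.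
rewrite -[RHS]vM0 (reindex (@enum_val _ (mem {: I}))) /=; last first.
  by exists enum_rank => i _; rewrite ?enum_valK ?enum_rankK.
apply: eq_bigr => a _; rewrite mcoeffZ ffunE enum_valK mxE; congr (_ * _).
rewrite /p; congr (mcoeff _ _); apply/mnmP => j.
by rewrite mnmE enum_rankK ffunE inordK // ltnS.
Qed.

(** A chain of length [n + 1] would contain [n + 1] algebraically independent
    elements. *)
Lemma prime_chain_le (P : S -> Prop) h : prime_chain P h -> (h <= n)%N.
Proof.
move=> [Q [Qpr Qlt _]]; rewrite leqNgt; apply/negP => lt_nh.
have /choice[y yP] i : exists y, (i < h)%N -> Q i.+1 y /\ ~ Q i y.
  case: (ltnP i h) => [/Qlt[_ [y yP]]|]; first by exists y.
  by exists 0.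
have [N [c c0 E]] := algebraic_dependence (fun i => y i).
pose A := [set a | c a != 0].
have := @chain_independent _ Q n.+1 y _ _ _ _ _ (fun a => (c a)%:MP) (fun a => (c a)^-1%:MP)
  (fun a l => a (inord l) : nat) 0 A isT.
have -> : \sum_(a in A) (c a)%:MP * \prod_(0 <= l < n.+1) y l ^+ a (inord l) = 0.
  rewrite -[RHS]E [RHS](bigID (mem A)) /= [X in _ + X]big1 ?addr0; last first.
    by move=> a; rewrite inE negbK => /eqP ->; rewrite scale0r.
  apply: eq_bigr => a _; rewrite mul_mpolyC big_mkord; congr (_ *: _).
  by apply: eq_bigr => i _; rewrite inord_val.
have [[Q0 _ _] _ _] := Qpr 0%N isT.
apply => //.
- by move=> i lei; apply: Qpr; apply: leq_trans lei lt_nh.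
- by move=> i lei; exact: (proj1 (Qlt i (leq_trans lei lt_nh))).
- by move=> i lei; have [] := yP i (leq_trans lei lt_nh).
- by move=> i lei; have [] := yP i (leq_trans lei lt_nh).
- apply: contra c0 => /eqP/setP A0; apply/eqP/ffunP => a; rewrite ffunE.
  by have := A0 a; rewrite !inE => /negbFE /eqP.
- by move=> a; rewrite inE => ca; rewrite -mpolyCM mulVf.
move=> a b _ _ ab; apply/ffunP => i; apply: val_inj.
by rewrite /= -(inord_val i); apply: ab; rewrite ltn_ord.
Qed.

Lemma prime_chain_extend (P P' : S -> Prop) h :
  prime_chain P h -> prime_ideal P' -> strict_sub P P' -> prime_chain P' h.+1.
Proof.
move=> [Q [Qpr Qlt QP]] prP' ltP; exists (fun i => if (i <= h)%N then Q i else P').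
split=> [i ih|i ih|x]; last by rewrite ltnn.
  by case: ifP => // /Qpr.
rewrite ltnS in ih; rewrite ih; case: ifP => [/Qlt //|/negbT hi].
have <- : h = i by lia.
by have [PP' [x [P'x Px]]] := ltP; split=> [z /QP/PP' //|]; exists x; split=> // /QP.
Qed.

Lemma monomial_prime_strict (C : {set 'I_n}) i : i \notin C ->
  strict_sub (monomial_prime (K := K) C) (monomial_prime (i |: C)).
Proof.
move=> iC; split=> [f|]; first exact/monomial_primeS/subsetUr.
exists 'X_i; rewrite !monomial_primeX; split.
  by exists i; rewrite ?setU11 // mnm1E eqxx.
by case=> j jC; rewrite mnm1E; case: eqP => // E; rewrite E jC in iC.
Qed.

Lemma prime_chain_enlarge (C D : {set 'I_n}) h : C \subset D ->
  prime_chain (monomial_prime (K := K) C) h ->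
  prime_chain (monomial_prime (K := K) D) (h + #|D :\: C|).
Proof.
move kE: #|D :\: C| => k; elim: k C h kE => [|k IH] C h kE CD ch.
  have /eqP -> : D == C by rewrite eqEsubset CD -setD_eq0 -cards_eq0 kE.
  by rewrite addn0.
have /card_gt0P[i] : (0 < #|D :\: C|)%N by rewrite kE.
rewrite inE => /andP[iC iD]; rewrite -addSnnS; apply: (IH (i |: C)).
- have : i \in D :\: C by rewrite inE iC.
  by rewrite setUC -setDDl => iDC; move: kE; rewrite (cardsD1 i) iDC => -[].
- by rewrite subUset sub1set iD.
- apply: prime_chain_extend ch _ (monomial_prime_strict iC); exact: monomial_prime_prime.
Qed.

(** Upper bound: prolonging a chain below the prime of [C] by the variables
    outside [C] must not exceed the dimension [n]. *)
Lemma monomial_prime_height (C : {set 'I_n}) :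
  has_height (monomial_prime (K := K) C) #|C|.
Proof.
split=> [|h ch].
  have -> : #|C| = (0 + #|C :\: set0|)%N by rewrite setD0.
  apply: prime_chain_enlarge (sub0set _) _; exists (fun _ => monomial_prime set0).
  by split=> // i _; exact: monomial_prime_prime.
have := prime_chain_le (prime_chain_enlarge (subsetT C) ch).
rewrite setTD; have := cardsC C; rewrite card_ord; lia.
Qed.

End Dimension.

(** * Edge ideal and cover ideal *)

Lemma has_height_unique (R : comNzRingType) (P : R -> Prop) h h' :
  has_height P h -> has_height P h' -> h = h'.
Proof.
by move=> [c m] [c' m']; apply/eqP; rewrite eqn_leq m ?m'.
Qed.

Section GraphIdeals.
Variables (n : nat) (K : fieldType) (G : sgraph 'I_n).
Local Notation S := {mpoly K[n]}.
Implicit Types (f : S) (m : 'X_{1..n}).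

Definition support (a : 'I_n -> nat) : {set 'I_n} := [set i | 0 < a i]%N.

Definition cover_supports : {set {set 'I_n}} :=
  [set C | `[< exists2 a : {ffun 'I_n -> nat}, mincov G 1 a & C = support a >]].

Lemma support_in (a : {ffun 'I_n -> nat}) : mincov G 1 a -> support a \in cover_supports.
Proof. by move=> ma; rewrite inE; apply/asboolP; exists a. Qed.

(** A monomial outside the edge ideal has independent support, so some minimal
    1-cover avoids it. *)
Lemma edge_idealE : edge_ideal K G = prime_inter cover_supports.
Proof.
have -> : edge_ideal K G = ideal_gen (fun g => exists2 u,
    (exists i j, adj G i j /\ u = (U_(i) + U_(j))%MM) & g = 'X_[u]).
  congr ideal_gen; apply/funext => g; apply/propext; split.
    by move=> [i [j [ij ->]]]; exists (U_(i) + U_(j))%MM; [exists i, j | rewrite mpolyXD].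
  by move=> [u [i [j [ij ->]]] ->]; exists i, j; rewrite mpolyXD.
apply/funext => f; apply/propext; rewrite monomial_ideal_mem; split.
  move=> H C; rewrite inE => /asboolP[a [Ca _] ->]; apply/monomial_primeP => m /H.
  move=> [u [i [j [ij ->]]] /mnm_lepP um].
  have [mi mj] : (0 < m i)%N /\ (0 < m j)%N.
    by have := um i; have := um j; rewrite !mnmDE !mnm1E !eqxx; lia.
  have [ai|ai] := posnP (a i); last by exists i; rewrite ?inE.
  by exists j; rewrite // inE; have := Ca _ _ ij; rewrite ai.
move=> H m mf; apply: contrapT => nex.
have [i j|a [ma a0]] := @mincov_avoid _ G [pred i | 0 < m i]%N.
  rewrite !inE => mi mj; apply/negP => ij; apply: nex.
  exists (U_(i) + U_(j))%MM; first by exists i, j.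
  have ij' : i != j by apply: contraTneq ij => ->; rewrite adj_irrefl.
  apply/mnm_lepP => l; rewrite mnmDE !mnm1E.
  case: (eqVneq i l) => [il|_]; case: (eqVneq j l) => [jl|_] //=; rewrite -?il -?jl //.
  by rewrite il jl eqxx in ij'.
have /monomial_primeP /(_ _ mf) [i] := H _ (support_in ma).
by rewrite inE => ai mi; rewrite (a0 i) ?inE // in ai.
Qed.

Lemma support_minimal (a b : {ffun 'I_n -> nat}) :
  mincov G 1 a -> mincov G 1 b -> support b \subset support a -> support b = support a.
Proof.
move=> ma mb /subsetP ba; suff /funext E : b =1 a by rewrite /support E.
apply: (mincov_min ma (proj1 mb)) => i.
have := ba i; rewrite !inE; have := mincov_le i mb.
by case: (b i) (a i) => [|[|?]] [|?] // _ /(_ isT).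
Qed.

Lemma num_ones_support (a : {ffun 'I_n -> nat}) : mincov G 1 a ->
  num_ones a = #|support a|.
Proof.
move=> ma; congr #|pred_of_set _|; apply/setP => i; rewrite !inE.
by have := mincov_le i ma; case: (a i) => [|[]].
Qed.

(** Supports of minimal 1-covers form an antichain, so their primes are exactly
    the associated ones, and the height of each is the number of ones. *)
Lemma unmixed_edge_ideal :
  (forall a b : {ffun 'I_n -> nat}, mincov G 1 a -> mincov G 1 b ->
     num_ones a = num_ones b) <->
  unmixed_ideal (edge_ideal K G).
Proof.
rewrite edge_idealE; split=> [H|[h Hh] a b ma mb].
  have [i j|a0 [ma0 _]] := @mincov_avoid _ G pred0; first by rewrite inE.
  exists #|support a0| => P /associated_prime_inter[C + ->].
  rewrite inE => /asboolP[a ma ->]; rewrite -(num_ones_support ma0) (H _ _ ma0 ma).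
  by rewrite (num_ones_support ma); exact: monomial_prime_height.
have height (c : {ffun 'I_n -> nat}) : mincov G 1 c -> num_ones c = h.
  move=> mc; rewrite (num_ones_support mc).
  apply: has_height_unique (monomial_prime_height K _) (Hh _ _).
  apply: inter_associated_prime; first exact: support_in.
  by move=> D; rewrite inE => /asboolP[d md ->]; exact: support_minimal.
by rewrite (height a) ?(height b).
Qed.

Lemma edgesP C : reflect (exists i j, adj G i j /\ C = [set i; j]) (C \in edges G).
Proof.
apply: (iffP imsetP) => [[[i j]]|[i [j [ij ->]]]].
  by rewrite inE => ij ->; exists i, j.
by exists (i, j).
Qed.

Lemma cover_idealE : cover_ideal K G = prime_inter (edges G).
Proof.
have genE (i j : 'I_n) : ideal_gen (fun g : S => g = 'X_i \/ g = 'X_j) = monomial_prime (K := K) [set i; j].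
  have -> : ideal_gen (fun g : S => g = 'X_i \/ g = 'X_j) = ideal_gen (fun g : S => exists2 u,
      (u = U_(i) \/ u = U_(j))%MM & g = 'X_[u]).
    congr ideal_gen; apply/funext => g; apply/propext; split.
      by case=> ->; [exists U_(i)%MM | exists U_(j)%MM]; auto.
    by move=> [u [] -> ->]; auto.
  apply/funext => f; apply/propext; rewrite monomial_ideal_mem monomial_primeP.
  have le1 l m : (U_(l) <= m)%MM = (0 < m l)%N.
    by rewrite lep1mP lt0n.
  split=> H m /H => [[u [] ->]|[l]]; rewrite ?le1.
  - by exists i; rewrite ?set21.
  - by exists j; rewrite ?set22.
  by rewrite !inE => /pred2P[] -> ml; [exists U_(i)%MM | exists U_(j)%MM]; rewrite ?le1; auto.
apply/funext => f; apply/propext; split=> [H C /edgesP[i [j [ij ->]]]|H i j ij].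
  by rewrite -genE; apply: H.
by rewrite genE; apply/H/edgesP; exists i, j.
Qed.

Lemma degree_on_edge i j m : adj G i j -> degree_on [set i; j] m = (m i + m j)%N.
Proof.
move=> ij; rewrite /degree_on big_setU1 ?big_set1 //= inE.
by apply: contraTneq ij => ->; rewrite adj_irrefl.
Qed.

Lemma ideal_pow_order (I : S -> Prop) (C : {set 'I_n}) k f :
  (forall g, I g -> monomial_prime C g) -> ideal_pow I k f -> order_on_ge C k f.
Proof.
move=> IC; apply: ideal_gen_sub; first exact: order_on_ge_ideal.
move=> g [F [IF ->]]; rewrite -[k in order_on_ge C k]card_ord -sum1_card.
apply: (big_ind2 (fun f k => order_on_ge C k f)) => [||i _]; last exact/IC.
  by move=> m.
by move=> x k1 y k2; exact: order_on_geM.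
Qed.

(** The variables [X_i] and [X_j] become elements of the cover ideal after
    multiplication by all the other variables; [c] copies of the first and [k - c] of the
    second fit into [m]. *)
Lemma ideal_pow_cover i j k m : adj G i j -> (k <= m i + m j)%N ->
  ideal_pow (cover_ideal K G) k (outside K [set i; j] ^+ k * 'X_[m]).
Proof.
move=> ij le_k; rewrite cover_idealE; set J := prime_inter _; set w := outside K _.
have [_ _ PM] : is_ideal (ideal_pow J k) := ideal_gen_is_ideal _.
have Jw l : l \in [set i; j] -> J (w * 'X_l).
  move=> lij C /edgesP[p [q [pq ->]]].
  have [[_ _ CM] _ _] := monomial_prime_prime K [set p; q].
  case: (boolP ([set p; q] \subset [set i; j])) => [sub|/negP/outside_prime].
    apply: CM; apply/monomial_primeX; exists l; last by rewrite mnm1E eqxx.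
    have /eqP -> // : [set p; q] == [set i; j].
    rewrite eqEcard sub !cards2; have -> : p != q by apply: contraTneq pq => ->; rewrite adj_irrefl.
    by case: (_ != _).
  by move=> Hw; rewrite mulrC; apply/CM/Hw.
pose c := minn (m i) k.
have E : (U_(i) *+ c + U_(j) *+ (k - c) <= m)%MM.
  apply/mnm_lepP => l; rewrite mnmDE !mulmnE !mnm1E.
  have ij' : i != j by apply: contraTneq ij => ->; rewrite adj_irrefl.
  case: (eqVneq i l) => [il|_]; case: (eqVneq j l) => [jl|_]; rewrite /c /=.
  - by rewrite il jl eqxx in ij'.
  - by rewrite -il; lia.
  - by rewrite -jl; lia.
  - by lia.
have -> : w ^+ k * 'X_[m] = 'X_[m - (U_(i) *+ c + U_(j) *+ (k - c))] *
    ((w * 'X_i) ^+ c * (w * 'X_j) ^+ (k - c)).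
  rewrite !exprMn mulrACA -exprD subnKC ?geq_minr // !mpolyXn -!mpolyXD.
  by rewrite addmA [((m - _) + _)%MM]addmC -addmA submK.
apply: (PM); rewrite -{1}(subnKC (geq_minr (m i) k)); apply: ideal_powM.
  by apply/ideal_pow_expr/Jw; rewrite set21.
by apply/ideal_pow_expr/Jw; rewrite set22.
Qed.

(** Symbolic powers are the intersections of the powers of the edge primes.  One
    inclusion cancels the denominator at the prime of an edge; for the other, a power of the
    variables off a suitable edge is a denominator. *)
Lemma symbolic_power_cover k f :
  symbolic_power (cover_ideal K G) k f <->
  forall m, m \in msupp f -> cov G k m.
Proof.
split=> [Hf m mf i j ij|Hf P [prP [g Pg]]].
  have aP : associated_prime (cover_ideal K G) (monomial_prime (K := K) [set i; j]).
    rewrite cover_idealE; apply: inter_associated_prime; first by apply/edgesP; exists i, j.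
    move=> D /edgesP[p [q [pq ->]]] sub; apply/eqP.
    rewrite eqEcard sub !cards2; have -> : p != q by apply: contraTneq pq => ->; rewrite adj_irrefl.
    by case: (_ != _).
  have [s ns /ideal_pow_order H] := Hf _ aP.
  rewrite -(degree_on_edge m ij).
  apply: (order_on_ge_cancel ns (H _ _)) => // h; rewrite cover_idealE.
  by apply; apply/edgesP; exists i, j.
have [i [j [ij ng]]] : exists i j, adj G i j /\ ~ monomial_prime [set i; j] g.
  apply: contrapT => nex; have [_ P1 _] := prP; apply/P1/Pg; rewrite mul1r cover_idealE.
  by move=> C /edgesP[i [j [ij ->]]]; apply: contrapT => ng; apply: nex; exists i, j.
have Pij r : P r -> monomial_prime [set i; j] r.
  move/Pg; rewrite cover_idealE => H.
  have [_ _ PM] := monomial_prime_prime K [set i; j].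
  by have /H /PM [] : [set i; j] \in edges G by apply/edgesP; exists i, j.
exists (outside K [set i; j] ^+ k).
  move=> /Pij; apply: prime_ideal_expr; first exact: monomial_prime_prime.
  by move/outside_prime; rewrite subxx.
have iI := ideal_gen_is_ideal _ : is_ideal (ideal_pow (cover_ideal K G) k).
have [I0 ID IM] := iI.
rewrite [X in _ * X]mpolyE mulr_sumr big_seq.
apply: (big_ind (ideal_pow (cover_ideal K G) k)) => // m /Hf Cm.
by rewrite -mul_mpolyC mulrCA; apply/IM/ideal_pow_cover => //; apply: Cm.
Qed.

End GraphIdeals.

(** * The symbolic fiber cone *)

Section FiberCone.
Variables (n : nat) (K : fieldType) (G : sgraph 'I_n).
Local Notation S := {mpoly K[n]}.
Local Notation J := (cover_ideal K G).
Local Notation rees := (sym_rees J).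
Implicit Types (p q : {poly S}) (u v : rees) (m : 'X_{1..n}).

Let rees_val : {rmorphism rees -> {poly S}} := (val : rees -> {poly S}).

Definition cov_poly p : Prop := forall k m, m \in msupp p`_k -> cov G k m.

Definition mincov_free p : Prop := forall k m, m \in msupp p`_k -> ~ mincov G k m.

Lemma rees_cov u : cov_poly (val u).
Proof.
by move=> k; apply/symbolic_power_cover; have /asboolP := valP u; apply.
Qed.

Lemma cov_rees p : cov_poly p -> exists u : rees, val u = p.
Proof.
move=> Cp; have Hp : p \in in_sym_rees J.
  by apply/asboolP => k; apply/symbolic_power_cover/Cp.
by exists (SymRees Hp).
Qed.

Lemma msupp_coefM p q k m : m \in msupp (p * q)`_k ->
  exists i m1 m2, [/\ (i <= k)%N, m1 \in msupp p`_i, m2 \in msupp q`_(k - i)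
                    & m = (m1 + m2)%MM].
Proof.
rewrite coefM => /msupp_sumP[i /msuppMP[m1 [m2 [m1p m2q E]]]].
by exists i, m1, m2; split; rewrite // -ltnS.
Qed.

(** If a sum of covers is minimal, so are the summands; hence these polynomials
    form an ideal. *)
Lemma mincov_freeM p q : cov_poly p -> cov_poly q -> mincov_free q ->
  mincov_free (p * q).
Proof.
move=> Cp Cq Nq k m /msupp_coefM[i [m1 [m2 [ik m1p m2q ->]]]] mm.
apply: (Nq _ _ m2q); apply: (mincov_addl (l := i) (b := m1)).
- rewrite subnK //; apply: mincov_ext mm => j.
  by rewrite mnmDE addnC.
- exact: Cq m2q.
- exact: Cp m1p.
Qed.

Lemma mincov_freeD p q : mincov_free p -> mincov_free q -> mincov_free (p + q).
Proof.
by move=> Np Nq k m; rewrite coefD => /msuppD_le; rewrite mem_cat => /orP[/Np|/Nq].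
Qed.

Lemma mincov_free0 : mincov_free 0.
Proof. by move=> k m; rewrite coef0 msupp0. Qed.

Lemma irrelevant_ext_free u : irrelevant_ext u -> mincov_free (val u).
Proof.
apply: (@ideal_gen_sub _ _ (fun u => mincov_free (val u))).
  split.
  - by rewrite (rmorph0 rees_val); exact: mincov_free0.
  - by move=> x y Nx Ny; rewrite (rmorphD rees_val); exact: mincov_freeD.
  move=> a x Nx; rewrite (rmorphM rees_val).
  by apply: mincov_freeM => //; exact: rees_cov.
move=> x [c Ic ->] k m; rewrite coefC; case: eqP => [->|_]; last by rewrite msupp0.
move=> mc mm; have : monomial_prime [set: 'I_n] c.
  move: Ic; apply: ideal_gen_sub; first exact: order_on_ge_ideal.
  by move=> f [i ->]; apply/monomial_primeX; exists i; rewrite ?inE // mnm1E eqxx.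
by move/monomial_primeP => /(_ _ mc) [i _]; have := mincov_le i mm; case: (m i).
Qed.

Lemma msupp_term c m k l m' :
  m' \in msupp ((c *: 'X_[m] : S)%:P * 'X^k)`_l -> m' = m /\ l = k.
Proof.
rewrite coefCM coefXn; case: eqP => [->|_]; last by rewrite mulr0 msupp0.
by rewrite mulr1 => /msuppZ_le; rewrite msuppX inE => /eqP.
Qed.

(** A cover that is not minimal can be lowered at some vertex, which exhibits its
    monomial as a variable times an element of the Rees algebra. *)
Lemma free_term c m k : cov G k m -> ~ mincov G k m ->
  exists2 u : rees, val u = (c *: 'X_[m])%:P * 'X^k & irrelevant_ext u.
Proof.
move=> Cm nm; have [i mi nt] : exists2 i, (0 < m i)%N &
    ~ exists2 j, adj G i j & (m i + m j = k)%N.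
  apply: contrapT => H; apply: nm; split=> // i mi; apply: contrapT => nt.
  by apply: H; exists i.
have le_im : (U_(i) <= m)%MM by rewrite lep1mP -lt0n.
have Cm' : cov G k (m - U_(i))%MM.
  move=> x y xy; have := cov_decr Cm nt xy.
  by rewrite !mnmBE !mnm1E ![i == _]eq_sym.
have [a aE] : exists a : rees, val a = (c *: 'X_[m - U_(i)])%:P * 'X^k.
  by apply: cov_rees => l m' /msupp_term[-> ->].
have [b bE] : exists b : rees, val b = ('X_i)%:P.
  by apply: cov_rees => l m'; rewrite coefC; case: eqP => [->|_] //; rewrite msupp0.
exists (a * b).
  rewrite (rmorphM rees_val) /= aE bE mulrAC -polyCM -!mul_mpolyC -mulrA.
  by congr ((_ * _)%:P * _); rewrite -mpolyXD (submK le_im).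
have [_ _ IM] : is_ideal (@irrelevant_ext n K J) := ideal_gen_is_ideal _.
apply: (IM); apply: ideal_gen_mem; exists 'X_i => //.
by apply: ideal_gen_mem; exists i.
Qed.

(** So the monomials of minimal covers form a basis of the fiber cone. *)
Lemma irrelevant_extP u : irrelevant_ext u <-> mincov_free (val u).
Proof.
split=> [|Nu]; first exact: irrelevant_ext_free.
pose Q p := exists2 v : rees, val v = p & irrelevant_ext v.
have [I0 ID _] : is_ideal (@irrelevant_ext n K J) := ideal_gen_is_ideal _.
have Q0 : Q 0 by exists 0; first exact: (rmorph0 rees_val).
have QD p q : Q p -> Q q -> Q (p + q).
  by move=> [v <- Iv] [w <- Iw]; exists (v + w); [exact: (rmorphD rees_val) | exact: ID].
have [v vE Iv] : Q (val u); last by rewrite -(val_inj vE).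
rewrite -[val u]coefK poly_def; apply: (big_ind Q) => // k _.
rewrite -mul_polyC [(val u)`_k]mpolyE rmorph_sum mulr_suml big_seq.
apply: (big_ind Q) => // m mu; apply: free_term; last exact: Nu mu.
exact: rees_cov mu.
Qed.

Lemma fiber_cone_domain :
  GRing.integral_domain_axiom (sym_fiber_cone J) <->
  (forall u v, mincov_free (val u * val v) -> mincov_free (val u) \/ mincov_free (val v)).
Proof.
have pi0 u : (\pi_(sym_fiber_cone J) u == 0)%qT = `[< irrelevant_ext u >].
  rewrite -[0](pi_zeror (s := sym_fiber_cone J)) -Quotient.idealrBE subr0.
  by [].
have piM u v : (\pi_(sym_fiber_cone J) (u * v) =
    \pi_(sym_fiber_cone J) u * \pi_(sym_fiber_cone J) v)%qT by rewrite rmorphM.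
split=> [H u v Nuv|H x y].
  have : (\pi_(sym_fiber_cone J) (u * v) == 0)%qT.
    by rewrite pi0; apply/asboolP/irrelevant_extP; rewrite (rmorphM rees_val).
  rewrite piM => /eqP/H; rewrite !pi0 => /orP[] /asboolP/irrelevant_extP; by auto.
rewrite -[x]reprK -[y]reprK -piM => /eqP; rewrite !pi0 => /asboolP/irrelevant_extP.
rewrite (rmorphM rees_val) => /H Huv; apply/orP.
by case: Huv => N; [left | right]; apply/asboolP/irrelevant_extP.
Qed.

(** Represents the class of [p] in the fiber cone when [p] is in the Rees algebra. *)
Definition mincov_part p : {poly S} :=
  \poly_(k < size p) \sum_(m <- msupp p`_k | `[< mincov G k m >]) p`_k@_m *: 'X_[m].

Lemma coef_mincov_part p k m :
  ((mincov_part p)`_k)@_m = if `[< mincov G k m >] then p`_k@_m else 0.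
Proof.
rewrite coef_poly; case: ltnP => [_|/(nth_default 0) ->]; last first.
  by rewrite mcoeff0 if_same.
rewrite raddf_sum /= -big_filter; case: (boolP (m \in msupp p`_k)) => [mp|mp]; last first.
  rewrite big_filter big_seq_cond big1.
    by move: mp; rewrite -mcoeff_eq0 => /eqP ->; rewrite if_same.
  move=> m' /andP[m'p _]; rewrite mcoeffZ mcoeffX; case: eqP => [E|_]; last by rewrite mulr0.
  by rewrite -E m'p in mp.
rewrite big_filter big_mkcond (bigD1_seq m) //= big1 ?addr0 => [|m' /negbTE m'm].
  by case: ifP => // _; rewrite mcoeffZ mcoeffX eqxx mulr1.
by case: ifP => // _; rewrite mcoeffZ mcoeffX m'm mulr0.
Qed.

Lemma mincov_part_min p k m : m \in msupp (mincov_part p)`_k -> mincov G k m.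
Proof. by rewrite mcoeff_msupp coef_mincov_part; case: asboolP; rewrite ?eqxx. Qed.

Lemma mincov_part_cov p : cov_poly (mincov_part p).
Proof. by move=> k m /mincov_part_min[]. Qed.

Lemma mincov_part_sub p k m : m \in msupp (p - mincov_part p)`_k ->
  m \in msupp p`_k /\ ~ mincov G k m.
Proof.
rewrite !mcoeff_msupp coefB mcoeffB coef_mincov_part.
by case: asboolP => // nm; rewrite ?subrr ?subr0 ?eqxx.
Qed.

(** The class of a product of monomials is zero exactly when the sum of the
    covers is not minimal.  Conversely, when minimal covers add up to minimal covers, the
    product of the minimal parts is computed in the domain of polynomials and survives in
    the fiber cone. *)
Lemma fiber_cone_domain_additive :
  GRing.integral_domain_axiom (sym_fiber_cone J) <-> mincov_additive G.
Proof.
rewrite fiber_cone_domain; split=> [H k l a b ma mb|add u v Nuv].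
  apply: contrapT => nab.
  have mono j (c : {ffun 'I_n -> nat}) : mincov G j c -> exists u : rees,
      val u = ('X_[[multinom c i | i < n]])%:P * 'X^j /\ ~ mincov_free (val u).
    move=> mc; have mc' : mincov G j [multinom c i | i < n].
      by apply: mincov_ext mc => i; rewrite mnmE.
    have [u uE] : exists u : rees, val u = ('X_[[multinom c i | i < n]])%:P * 'X^j.
      apply: cov_rees => l' m; rewrite -[X in X%:P]scale1r => /msupp_term[-> ->].
      by case: mc'.
    exists u; split=> // /(_ j [multinom c i | i < n]); rewrite uE.
    by rewrite coefCM coefXn eqxx mulr1 msuppX inE eqxx => /(_ isT).
  have [u [uE nu]] := mono _ _ ma; have [v [vE nv]] := mono _ _ mb.
  have [|//|//] := H u v.
  rewrite uE vE mulrACA -polyCM -mpolyXD -exprD => j m.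
  rewrite -[X in X%:P]scale1r => /msupp_term[-> ->]; contradict nab.
  by apply: mincov_ext nab => i; rewrite ffun_addE mnmDE !mnmE.
apply: contrapT => /not_orP[nu nv].
have part_neq0 p : ~ mincov_free p -> mincov_part p != 0.
  move=> np; apply/eqP => p0; apply: np => k m mp mm.
  have := coef_mincov_part p k m; rewrite p0 coef0 mcoeff0; case: asboolP => // _.
  by move/esym/eqP; rewrite mcoeff_eq0 mp.
have : mincov_part (val u) * mincov_part (val v) != 0 by rewrite mulf_neq0 ?part_neq0.
rewrite -lead_coef_eq0 -msupp_eq0 lead_coefE; set k := _.-1.
case E: (msupp _) => [//|m s] _.
have {s E} mt : m \in msupp (mincov_part (val u) * mincov_part (val v))`_k.
  by rewrite E mem_head.
have mm : mincov G k m.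
  have [i [m1 [m2 [ik /mincov_part_min mm1 /mincov_part_min mm2 ->]]]] := msupp_coefM mt.
  rewrite -(subnKC ik).
  apply: mincov_ext (add i (k - i)%N [ffun j => m1 j] [ffun j => m2 j] _ _).
  - by move=> j; rewrite ffun_addE !ffunE mnmDE.
  - by apply: mincov_ext mm1 => j; rewrite ffunE.
  - by apply: mincov_ext mm2 => j; rewrite ffunE.
have part_free (w : rees) : mincov_free (val w - mincov_part (val w)).
  by move=> j m' /mincov_part_sub[].
have part_cov (w : rees) : cov_poly (val w - mincov_part (val w)).
  by move=> j m' /mincov_part_sub[mw _]; exact: (@rees_cov w j m' mw).
have Nd : mincov_free (val u * val v - mincov_part (val u) * mincov_part (val v)).
  have E (a b c d : {poly S}) : a * b - c * d = c * (b - d) + b * (a - c).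
    by rewrite !mulrBr [b * a]mulrC [b * c]mulrC [RHS]addrC subrKA.
  rewrite E.
  apply: mincov_freeD; apply: mincov_freeM => //; first exact: mincov_part_cov.
  exact: rees_cov.
have : m \in msupp (val u * val v)`_k.
  move: mt; rewrite !mcoeff_msupp.
  have : m \notin msupp (val u * val v - mincov_part (val u) * mincov_part (val v))`_k.
    by apply/negP => /Nd.
  by rewrite -mcoeff_eq0 coefB mcoeffB subr_eq0 => /eqP ->.
by move/Nuv.
Qed.

End FiberCone.

(** * The equivalences *)

Theorem theorem2p8 (n : nat) (n_gt0 : (0 < n)%N) (G : sgraph 'I_n)
    (G_noiso : forall i, ~~ isolated G i) (K : fieldType) :
  [<-> MSC G;
       forall k : nat, (1 <= k)%N -> forall a, basic_kcover G k a ->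
         (norm_cover a)%:R = (k * n)%:R / 2%:R :> rat;
       forall k : nat, (1 <= k)%N -> forall a b,
         basic_kcover G k a -> basic_kcover G k b -> norm_cover a = norm_cover b;
       unmixed_graph G /\ domain_graph G;
       GRing.integral_domain_axiom (sym_fiber_cone (cover_ideal K G)) /\
         unmixed_ideal (edge_ideal K G);
       forall x : red_vertex G, exists2 a : nat, (0 < a)%N &
         complete_bipartite_on (graph01 G) (component (graph01 G) x) a a;
       has_perfect_matching (graph01 G);
       has_perfect_matching G /\
         forall a, basic_kcover G 1 a ->
           (num_ones a)%:R = n%:R / 2%:R :> rat].
Proof.
have T_gt0 : (0 < #|'I_n|)%N by rewrite card_ord.
have basicP k (a : {ffun 'I_n -> nat}) : (0 < k)%N ->
  basic_kcover G k a <-> mincov G k a by move=> k_gt0; apply: basic_mincov.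
have unmixedP : unmixed_graph G <-> (forall a b : {ffun 'I_n -> nat},
    mincov G 1 a -> mincov G 1 b -> num_ones a = num_ones b).
  by split=> H a b /(basicP 1%N _ isT) ma /(basicP 1%N _ isT) mb; apply: H.
tfae.
- move=> msc k k_gt0 a /(basicP k _ k_gt0) ma; apply/eq_half_rat.
  by rewrite (MSC_norm G_noiso msc ma) card_ord.
- move=> H k k_gt0 a b /(H k k_gt0) /eq_half_rat Ea /(H k k_gt0) /eq_half_rat Eb.
  by lia.
- move=> H; have Hm k (a b : {ffun 'I_n -> nat}) : (0 < k)%N ->
      mincov G k a -> mincov G k b -> norm_cover a = norm_cover b.
    by move=> k_gt0 /(basicP k _ k_gt0) ma /(basicP k _ k_gt0); apply: H ma.
  split; last by apply/domain_graph_additive => //; apply: constant_norm_additive.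
  apply/unmixedP => a b ma mb; rewrite (num_ones_norm ma) (num_ones_norm mb).
  exact: Hm ma mb.
- move=> [/unmixedP unm dom]; split; last exact/unmixed_edge_ideal.
  by apply/fiber_cone_domain_additive/domain_graph_additive.
- move=> [/fiber_cone_domain_additive add /unmixed_edge_ideal unm] u.
  by apply: component_balanced => //; apply/unmixedP.
- exact: balanced_matching.
- move=> /(matching01 G_noiso T_gt0)[pm half]; split=> // a /(basicP 1%N _ isT) ma.
  by apply/eq_half_rat; rewrite half // card_ord.
- move=> [pm half]; apply: (matching_half_MSC G_noiso T_gt0 pm) => a ma.
  by rewrite card_ord; apply/eq_half_rat/half/basicP.
Qed.
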